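(* There exists a constant $C_{3,3}$ with $0.6919\leq C_{3,3}\leq 0.7136$ such that $F_{3,3}(n)=(C_{3,3}+o(1))n$ as $n\to\infty$.
   Context: For integers $k\ge2$, $d\ge2$, $n\ge1$, $F_{k,d}(n)$ is the maximal size of a set $A\subseteq\{1,\dots,n\}$ such that the equation $a_1a_2\cdots a_k=x^d$ with $a_1<a_2<\dots<a_k$ has no solution with $a_1,\dots,a_k\in A$ and $x$ an integer. *)

(* Defs.v *)
From HB Require Import structures.
From mathcomp Require Import all_boot all_order all_algebra.
From mathcomp Require Import all_classical all_reals all_analysis.

Set Implicit Arguments.
Unset Strict Implicit.
Unset Printing Implicit Defensive.

Import Order.TTheory GRing.Theory Num.Theory.
Import numFieldNormedType.Exports.

Local Open Scope classical_set_scope.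
Local Open Scope ring_scope.

(* Subsets of {1, ..., n} are encoded as sets A : {set 'I_n.+1} (so inside
   {0, ..., n}) with ord0 \notin A. *)
Definition has_power_product (k d n : nat) (A : {set 'I_n.+1}) : Prop :=
  exists (a : 'I_k -> 'I_n.+1) (x : int),
    [/\ forall i j : 'I_k, (i < j)%N -> (a i < a j)%N,
        forall i : 'I_k, a i \in A
      & (\prod_(i < k) (a i : nat))%N%:Z = x ^+ d].

Definition power_product_free (k d n : nat) (A : {set 'I_n.+1}) : Prop :=
  ord0 \notin A /\ ~ has_power_product k d A.

Definition F (k d n : nat) : nat :=
  \max_(A : {set 'I_n.+1} | `[< power_product_free k d A >]) #|A|.

(* Main.v *)
(* For a modulus P, write each a <= n as u * v, where u has only prime factors
   dividing P (u is smooth) and v is coprime to P. For fixed v the numbers u form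
   a solution-free set of smooth numbers <= n / v, so, G x denoting the largest
   size of such a set in {1, ..., x},
     F n <= U n := \sum_(v <= n, v coprime to P) G (n / v).
   Writing v = m^2 w with w squarefree also gives
     U n <= \sum_(m <= n, m coprime to P) F (n / m^2).
   As G is a bounded step function, U n = c_P n + O(1), and
   c_P = phi(P) / P * \sum_j 1 / j over the jumps j of G. With P = k!, k -> oo, the
   terms with m > 1 become negligible, hence the limit C exists. With P = 210, the
   same two inequalities give c_P / Z <= C <= c_P where Z is the sum of 1 / m^2
   over m coprime to 210.

   For P = 210, send a smooth number to the exponents of 2, 3, 5, 7 modulo 3, a
   point of F_3^4. A product of three smooth numbers is a cube iff their points
   are equal or form a line; so the points of a solution-free set form a cap and
   each of them is used at most twice. Hence G x is the largest weight of a cap,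
   the weight of a point being the number of elements <= x among r and 8 r, with r
   the least number in its class. Caps of large weight are excluded by branching
   and linear programming duality from the bounds 2, 4, 9, 20 for the size of a
   cap in dimension 1, 2, 3, 4. *)
From Stdlib Require Import ZArith Lia.
From HB Require Import structures.
From mathcomp Require Import all_boot all_order all_algebra.
From mathcomp Require Import all_classical all_reals all_analysis.
From mathcomp Require Import zify ring lra.
Require Import Defs.

Set Implicit Arguments.
Unset Strict Implicit.
Unset Printing Implicit Defensive.

(** * Caps in affine spaces over F_3 *)

(** The obstacle to a matching lower bound is that optimal smooth sets for different rough parts v
    cannot simply be united: distinct rough parts such as 1, 11, 121 may multiply to a cube.
    Distinct squarefree rough parts cannot, and any other v is charged to a smaller problem through
    v = m^2 w; the factor Z is the price. It accounts for nearly the whole gap between 0.6919 and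
    0.7136, since the upper and lower bounds used for G differ at two jumps only.

    The bound 20 in dimension 4 comes from double counting over the 40 parallel classes of
    hyperplanes: the section sizes of a cap have prescribed second and third moments, and together
    with the bound 9 for each section these rule out 21 points. The facts of linear algebra over F_3
    that this uses are checked by evaluation on all points. *)

Inductive trit := T0 | T1 | T2.

Definition eqtrit (x y : trit) :=
  match x, y with T0, T0 | T1, T1 | T2, T2 => true | _, _ => false end.

Lemma eqtritP : Equality.axiom eqtrit.
Proof. by move=> [] []; constructor. Qed.

HB.instance Definition _ := hasDecEq.Build trit eqtritP.

Definition trits := [:: T0; T1; T2].

Definition topp x := match x with T0 => T0 | T1 => T2 | T2 => T1 end.

Definition tadd x y :=
  match x, y with
  | T0, z | z, T0 => z
  | T1, T1 => T2
  | T2, T2 => T1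
  | _, _ => T0
  end.

Definition tmul x y :=
  match x, y with
  | T0, _ | _, T0 => T0
  | T1, z | z, T1 => z
  | T2, T2 => T1
  end.

Definition point := seq trit.

Fixpoint zipw (f : trit -> trit -> trit) (p q : point) : point :=
  match p, q with
  | x :: p', y :: q' => f x y :: zipw f p' q'
  | _, _ => [::]
  end.

Definition padd := zipw tadd.
Definition psub := zipw (fun x y => tadd x (topp y)).
Definition pscale x : point -> point := map (tmul x).

(* The third point of the line through two distinct points. *)
Definition third := zipw (fun x y => topp (tadd x y)).
Fixpoint dot (f p : point) : trit :=
  match f, p with
  | a :: f', x :: p' => tadd (tmul a x) (dot f' p')
  | _, _ => T0
  end.

Fixpoint points n : seq point :=
  if n is m.+1 then
    [seq T0 :: p | p <- points m] ++ [seq T1 :: p | p <- points m]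
      ++ [seq T2 :: p | p <- points m]
  else [:: [::]].

Lemma mem_cons_map (x y : trit) (p : point) (s : seq point) :
  (x :: p \in [seq y :: q | q <- s]) = (x == y) && (p \in s).
Proof.
apply/mapP/andP => [[q qs [-> ->]]|[/eqP-> ps]]; first by rewrite eqxx.
by exists p.
Qed.

Lemma mem_points n p : (p \in points n) = (size p == n).
Proof.
elim: n p => [|n IH] [|x p] //=.
  have H x : ([::] \in [seq x :: p | p <- points n]) = false.
    by apply/negP => /mapP[].
  by rewrite !mem_cat !H.
by rewrite !mem_cat !mem_cons_map IH eqSS; case: x; rewrite /= ?orbF.
Qed.

Lemma uniq_points n : uniq (points n).
Proof.
elim: n => [//|n IH] /=.
have inj x : injective (cons x : point -> point) by move=> p q [].
have disj x y : x != y ->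
    ~~ has [in [seq x :: p | p <- points n]] [seq y :: p | p <- points n].
  move=> xy; apply/hasPn => _ /mapP[p _ ->].
  by rewrite mem_cons_map eq_sym (negPf xy).
by rewrite !cat_uniq !(map_inj_uniq (@inj _)) IH has_cat !negb_or !disj.
Qed.

Lemma size_zipw f p q : size (zipw f p q) = minn (size p) (size q).
Proof. by elim: p q => [|x p IH] [|y q] //=; rewrite IH minnSS. Qed.

Lemma dot_psub f p q : size p = size q ->
  (dot f p == dot f q) = (dot f (psub p q) == T0).
Proof.
suff H : size p = size q -> dot f (psub p q) = tadd (dot f p) (topp (dot f q)).
  by move=> pq; rewrite H //; case: (dot f p); case: (dot f q).
elim: f p q => [|a f IH] [|x p] [|y q] //= [] pq; rewrite IH //.
by case: a; case: x; case: y; case: (dot f p); case: (dot f q).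
Qed.

Lemma psub_eq0 n p q : size p = n -> size q = n ->
  (psub p q == nseq n T0) = (p == q).
Proof.
elim: n p q => [|n IH] [|x p] [|y q] //= [] sp [] sq.
by rewrite !eqseq_cons IH //; case: x; case: y.
Qed.

Lemma psub_eq n p q r : size p = n -> size q = n -> size r = n ->
  (psub q p == psub r p) = (q == r).
Proof.
elim: n p q r => [|n IH] [|x p] [|y q] [|z r] //= [] sp [] sq [] sr.
by rewrite !eqseq_cons IH //; case: x; case: y; case: z.
Qed.

Lemma psub_eqN n p q r : size p = n -> size q = n -> size r = n ->
  (psub r p == map topp (psub q p)) = (r == third p q).
Proof.
elim: n p q r => [|n IH] [|x p] [|y q] [|z r] //= [] sp [] sq [] sr.
by rewrite !eqseq_cons IH //; case: x; case: y; case: z.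
Qed.

Lemma third_eql p q : size p = size q -> third p q = p -> p = q.
Proof.
elim: p q => [|x p IH] [|y q] //= [] spq [+ /(IH _ spq)->].
by case: x; case: y.
Qed.

Lemma third_eqr p q : size p = size q -> third p q = q -> p = q.
Proof.
elim: p q => [|x p IH] [|y q] //= [] spq [+ /(IH _ spq)->].
by case: x; case: y.
Qed.

(** Over F_3 three distinct points are collinear iff their sum is 0. A predicate instead of a list
    makes restriction to a flat a composition with its parametrization [emb]. *)
Definition cap n (C : pred point) :=
  forall p q, p \in points n -> q \in points n ->
    C p -> C q -> p != q -> ~~ C (third p q).

Fixpoint emb (o : point) (ds : seq point) (t : point) : point :=
  match ds, t with
  | d :: ds', x :: t' => emb (padd o (pscale x d)) ds' t'
  | _, _ => o
  end.

Definition flat o ds := [seq emb o ds t | t <- points (size ds)].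

Lemma size_emb n o ds t : size o = n -> all (fun d => size d == n) ds ->
  size (emb o ds t) = n.
Proof.
elim: ds t o => [|d ds IH] [|x t] o //= so /andP[/eqP sd] /IH; apply.
by rewrite size_zipw size_map so sd minnn.
Qed.

(** Affine maps preserve lines. Two origins are allowed because the recursion of [emb] moves them
    independently. *)
Lemma third_emb o1 o2 ds t u : size t = size ds -> size u = size ds ->
  third (emb o1 ds t) (emb o2 ds u) = emb (third o1 o2) ds (third t u).
Proof.
elim: ds t u o1 o2 => [|d ds IH] [|x t] [|y u] o1 o2 //= [] st [] su.
rewrite IH //; congr (emb _ ds _); rewrite /third /padd /pscale.
elim: o1 o2 d {IH} => [|a o1 IH] [|b o2] [|c d] //=; rewrite IH.
by congr cons; move: x y {IH} => [] []; case: a; case: b; case: c.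
Qed.

Lemma third_id p : third p p = p.
Proof. by rewrite /third; elim: p => //= x p ->; case: x. Qed.

(** A cap pulls back to a cap along an injective affine map; the absence of duplicates in the listed
    flat stands for independence of the directions. *)
Lemma cap_emb n C o ds : cap n C ->
  all (fun d => size d == n) (o :: ds) -> uniq (flat o ds) ->
  cap (size ds) (C \o emb o ds).
Proof.
move=> capC /andP[/eqP so sds] us p q pP qP Cp Cq pq /=.
have := pP; have := qP; rewrite !mem_points => /eqP sq /eqP sp.
rewrite -{1}(third_id o) -third_emb //.
apply: capC; rewrite ?mem_points ?(size_emb _ so) //.
apply: contraNneq pq => e.
have /eqP : nth [::] (flat o ds) (index p (points (size ds))) =
            nth [::] (flat o ds) (index q (points (size ds))).
  by rewrite !(nth_map [::]) ?index_mem // !nth_index.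
rewrite nth_uniq ?size_map ?index_mem // => /eqP.
by move/(congr1 (nth [::] (points (size ds)))); rewrite !nth_index // => ->.
Qed.

(* One functional for each of the (3^n - 1) / 2 directions of parallel
   hyperplanes. *)
Fixpoint functionals n : seq point :=
  if n is m.+1 then
    [seq T1 :: p | p <- points m] ++ [seq T0 :: p | p <- functionals m]
  else [::].

Fixpoint units n : seq point :=
  if n is m.+1 then (T1 :: nseq m T0) :: map (cons T0) (units m) else [::].

(** Solves f . x = r when the first nonzero coordinate of f is 1: coordinates before the pivot are
    free, and the pivot is r minus the form g in the later ones. Hence the entry -g_i at the pivot
    next to the i-th unit vector. *)
Fixpoint hyperplane (f : point) (r : trit) : point * seq point :=
  match f with
  | T0 :: g => let: (o, ds) := hyperplane g r in
      (T0 :: o, (T1 :: nseq (size g) T0) :: map (cons T0) ds)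
  | _ :: g => (r :: nseq (size g) T0,
               [seq topp x.1 :: x.2 | x <- zip g (units (size g))])
  | [::] => ([::], [::])
  end.

(** The inclusion of the hyperplane in the flat is the direction that bounds sections from above. *)
Definition hyperplane_ok n :=
  all (fun f => all (fun r =>
    let: (o, ds) := hyperplane f r in
    let s := flat o ds in
    [&& size ds == n.-1, all (fun d => size d == n) (o :: ds), uniq s
      & all (fun p => if dot f p == r then p \in s else true) (points n)])
    trits) (functionals n).

(** The intended values are N = (3^n - 1) / 2, the number of functionals up to sign, and k =
    (3^(n-1) - 1) / 2, the number of those vanishing at a given nonzero d. *)
Definition zeros_ok n N k :=
  all (fun d => count (fun f => dot f d == T0) (functionals n) ==
                (if d == nseq n T0 then N else k)) (points n).

(** Functionals vanishing at both d and e: there are k of them if e lies in the span {0, d, -d}, and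
    l = (3^(n-2) - 1) / 2 otherwise. *)
Definition zeros2_ok n k l :=
  all (fun d => if d == nseq n T0 then true else
    let F := [seq f <- functionals n | dot f d == T0] in
    all (fun e => count (fun f => dot f e == T0) F ==
      (if [|| e == nseq n T0, e == d | e == map topp d] then k else l))
      (points n)) (points n).

(** * Moments of the hyperplane sections of a cap *)

Section Fibers.
Variables (T : eqType) (g : T -> trit) (S : seq T).

(** Written as a sum of zeros and ones, so that its powers expand into counts of pairs and triples
    with equal values. *)
Definition fib r := \sum_(p <- S) (g p == r : nat).

Lemma sum_fib : \sum_(r <- trits) fib r = size S.
Proof.
rewrite exchange_big /= -sum1_size; apply: eq_bigr => p _.
by rewrite !big_cons big_nil; case: (g p).
Qed.

Lemma sum_fib2 :
  \sum_(r <- trits) fib r ^ 2 =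
  \sum_(p <- S) \sum_(q <- S) (g p == g q : nat).
Proof.
under eq_bigr do rewrite -mulnn big_distrlr.
rewrite exchange_big /=; apply: eq_bigr => p _.
rewrite exchange_big /=; apply: eq_bigr => q _.
by rewrite !big_cons big_nil; case: (g p); case: (g q).
Qed.

Lemma sum_fib3 :
  \sum_(r <- trits) fib r ^ 3 =
  \sum_(p <- S) \sum_(q <- S) \sum_(s <- S) ((g p == g q) && (g p == g s) : nat).
Proof.
under eq_bigr do rewrite expnS big_distrl.
rewrite exchange_big /=; apply: eq_bigr => p _.
under eq_bigr do rewrite -mulnn big_distrlr big_distrr.
rewrite exchange_big /=; apply: eq_bigr => q _.
under eq_bigr do rewrite big_distrr.
rewrite exchange_big /=; apply: eq_bigr => s _.
by rewrite !big_cons big_nil; case: (g p); case: (g q); case: (g s).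
Qed.
End Fibers.

Lemma sum_const (T : Type) (S : seq T) a : \sum_(p <- S) a = size S * a.
Proof. by rewrite big_const_seq count_predT iter_addn_0 mulnC. Qed.

Lemma sum_if_mem (T : eqType) (S : seq T) p a b : uniq S -> p \in S ->
  \sum_(q <- S) (if p == q then a else b) = a + (size S).-1 * b.
Proof.
move=> uS pS; rewrite (perm_big _ (perm_to_rem pS)) big_cons eqxx; congr addn.
rewrite (eq_big_seq (fun=> b)); last first.
  by move=> q; rewrite mem_rem_uniq // inE eq_sym; case: eqP.
by rewrite big_const_seq count_predT iter_addn_0 size_rem // mulnC.
Qed.

Section Counting.
Variables (n N k l : nat) (S : seq point).
Hypotheses (uS : uniq S) (SP : {subset S <= points n}).
Hypothesis zok : zeros_ok n N k.

Lemma count_dot p q : p \in S -> q \in S ->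
  \sum_(f <- functionals n) (dot f p == dot f q : nat) = if p == q then N else k.
Proof.
move=> /SP; rewrite mem_points => /eqP sp /SP; rewrite mem_points => /eqP sq.
rewrite -(psub_eq0 sp sq).
have dP : psub p q \in points n by rewrite mem_points size_zipw sp sq minnn.
rewrite -(eqP (allP zok _ dP)) -sum1_count [RHS]big_mkcond /=.
by apply: eq_bigr => f _; rewrite dot_psub ?sp ?sq //; case: eqP.
Qed.

(** Counts triples (f, p, q) with f p = f q: the case q = p occurs for all N functionals, any other
    q for the k that vanish at p - q. *)
Lemma sum_squares :
  \sum_(f <- functionals n) \sum_(r <- trits) fib (dot f) S r ^ 2 =
  size S * (N + (size S).-1 * k).
Proof.
under eq_bigr do rewrite sum_fib2.
rewrite exchange_big /= -sum_const.
apply: eq_big_seq => p pS; rewrite exchange_big /= -(sum_if_mem _ _ uS pS).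
by apply: eq_big_seq => q qS; rewrite count_dot.
Qed.

(** Counts (f, p, q, s) with f p = f q = f s. For p <> q, a point s on the line through p and q
    occurs k times and any other l times; the cap property removes the third point of that line. *)
Lemma sum_cubes (C : pred point) : cap n C -> all C S -> zeros2_ok n k l ->
  \sum_(f <- functionals n) \sum_(r <- trits) fib (dot f) S r ^ 3 =
  size S * (N + (size S).-1 * k + (size S).-1 * (k + k + (size S).-2 * l)).
Proof.
move=> capC /allP CS zok2; have sz p : p \in S -> size p = n.
  by move/SP; rewrite mem_points => /eqP.
under eq_bigr do rewrite sum_fib3.
rewrite exchange_big /= -sum_const.
apply: eq_big_seq => p pS; rewrite exchange_big /= -addnA.
have -> : N + ((size S).-1 * k + (size S).-1 * (k + k + (size S).-2 * l)) =
  (N + (size S).-1 * k) + (size S).-1 * (k + k + (size S).-2 * l) by lia.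
rewrite -(sum_if_mem _ _ uS pS); apply: eq_big_seq => q qS.
rewrite exchange_big /=.
case: (eqVneq p q) => [<-|pq].
  rewrite -(sum_if_mem _ _ uS pS); apply: eq_big_seq => s sS.
  by under eq_bigr do rewrite eqxx /=; rewrite count_dot.
have [d0 dP] : psub q p != nseq n T0 /\ psub q p \in points n.
  by rewrite (psub_eq0 (n := n)) ?sz // eq_sym pq mem_points size_zipw !sz ?minnn.
have E s : s \in S ->
  \sum_(f <- functionals n) ((dot f p == dot f q) && (dot f p == dot f s) : nat)
  = if [|| s == p, s == q | s == third p q] then k else l.
  move=> sS.
  have eP : psub s p \in points n by rewrite mem_points size_zipw !sz ?minnn.
  have /allP/(_ _ dP) := zok2; rewrite (negPf d0) => /allP/(_ _ eP)/eqP.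
  rewrite (psub_eq0 (n := n)) ?(psub_eq (n := n)) ?(psub_eqN (n := n)) ?sz //.
  rewrite [s == p]eq_sym => <-.
  rewrite count_filter -sum1_count [RHS]big_mkcond /=; apply: eq_bigr => f _.
  rewrite ![dot f p == _]eq_sym !dot_psub ?sz //= andbC.
  by case: (_ && _).
have nt s : s \in S -> (s == third p q) = false.
  move=> sS; apply: contraTF (CS _ sS) => /eqP->.
  by apply: capC => //; [exact: SP|exact: SP|exact: CS|exact: CS].
rewrite (eq_big_seq (fun s => if s == p then k else if s == q then k else l)).
  rewrite (perm_big _ (perm_to_rem pS)) big_cons eqxx -addnA; congr addn.
  have qS' : q \in rem p S by rewrite mem_rem_uniq // inE eq_sym pq.
  rewrite -[(size S).-2]/((size S).-1.-1) -(size_rem pS).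
  rewrite -(sum_if_mem _ _ (rem_uniq _ uS) qS').
  apply: eq_big_seq => s; rewrite mem_rem_uniq // inE => /andP[/negPf-> _].
  by rewrite eq_sym.
by move=> s sS; rewrite E // nt // orbF; case: eqP; case: eqP.
Qed.
End Counting.

Lemma fib_count (T : eqType) (g : T -> trit) S r :
  fib g S r = count (fun p => g p == r) S.
Proof.
rewrite /fib -sum1_count [RHS]big_mkcond /=.
by apply: eq_bigr => p _; case: eqP.
Qed.

Lemma count_flat n C o ds b : cap n C ->
  all (fun d => size d == n) (o :: ds) -> uniq (flat o ds) ->
  (forall C', cap (size ds) C' -> count C' (points (size ds)) <= b) ->
  count C (flat o ds) <= b.
Proof.
move=> capC sz us H; rewrite /flat count_map.
exact: (H _ (cap_emb capC sz us)).
Qed.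

(** The section lies in a flat whose parametrization pulls [C] back to a cap of dimension n - 1. *)
Lemma fib_le n b C S f r : cap n C -> all C S -> uniq S ->
  {subset S <= points n} -> hyperplane_ok n -> f \in functionals n ->
  (forall C', cap n.-1 C' -> count C' (points n.-1) <= b) ->
  fib (dot f) S r <= b.
Proof.
move=> capC /allP CS uS SP /allP ok fF H; rewrite fib_count.
have rT : r \in trits by case: r.
have /allP/(_ r rT) := ok f fF; case: hyperplane => o ds.
case/and4P => /eqP sds sz us /allP cov.
apply: (@leq_trans (count C (flat o ds))); last first.
  by apply: (count_flat capC sz us); rewrite sds.
rewrite -!size_filter; apply: uniq_leq_size; first exact: filter_uniq.
move=> p; rewrite !mem_filter => /andP[/eqP pr pS].
by have := cov p (SP p pS); rewrite pr eqxx (CS _ pS) => ->.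
Qed.

(** Part of a cap is a cap, so only one size has to be excluded, and for a fixed size the moments
    are plain numbers. *)
Lemma count_le_sub n C b : 
  (forall S, uniq S -> {subset S <= points n} -> all C S -> size S != b.+1) ->
  count C (points n) <= b.
Proof.
move=> H; rewrite leqNgt; apply/negP => lt.
suff : size (take b.+1 [seq p <- points n | C p]) != b.+1.
  by rewrite size_takel ?eqxx // size_filter.
apply: H.
- exact/take_uniq/filter_uniq/uniq_points.
- by move=> p /mem_take; rewrite mem_filter => /andP[].
- by apply/allP => p /mem_take; rewrite mem_filter => /andP[].
Qed.

Lemma leq_sum_seq_const (T : eqType) (s : seq T) (F : T -> nat) b :
  (forall x, x \in s -> F x <= b) -> \sum_(x <- s) F x <= size s * b.
Proof.
by move=> H; rewrite -sum_const big_seq [leqRHS]big_seq; apply: leq_sum.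
Qed.

(** * Largest caps in dimensions one to four *)

Lemma cap1 C : cap 1 C -> count C (points 1) <= 2.
Proof.
move=> /(_ [:: T0] [:: T1] isT isT) /=.
by case: (C [:: T0]); case: (C [:: T1]); case: (C [:: T2]) => // /(_ isT isT isT).
Qed.

Lemma hyperplane_ok2 : hyperplane_ok 2. Proof. by vm_compute. Qed.
Lemma hyperplane_ok3 : hyperplane_ok 3. Proof. by vm_compute. Qed.
Lemma hyperplane_ok4 : hyperplane_ok 4. Proof. by vm_compute. Qed.
Lemma zeros_ok2 : zeros_ok 2 4 1. Proof. by vm_compute. Qed.
Lemma zeros_ok3 : zeros_ok 3 13 4. Proof. by vm_compute. Qed.
Lemma zeros_ok4 : zeros_ok 4 40 13. Proof. by vm_compute. Qed.
Lemma zeros2_ok4 : zeros2_ok 4 13 4. Proof. by vm_compute. Qed.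

Lemma cap2 C : cap 2 C -> count C (points 2) <= 4.
Proof.
move=> capC; apply: count_le_sub => S uS SP CS; apply/eqP => sS.
have := sum_squares uS SP zeros_ok2; rewrite sS => E.
(* Sizes at most 2 with sum 5 are 2, 2, 1, whose squares add up to 9, while 4 * 9 < 40. *)
suff : 40 <= size (functionals 2) * 9 by [].
rewrite -[40]/(5 * (4 + 5.-1 * 1)) -E; apply: leq_sum_seq_const => f fF.
have := sum_fib (dot f) S; rewrite sS !big_cons !big_nil.
have := fib_le _ capC CS uS SP hyperplane_ok2 fF cap1.
move=> H; move: (H T0) (H T1) (H T2).
case: (fib _ _ T0) => [|[|[|]]] //; case: (fib _ _ T1) => [|[|[|]]] //;
by case: (fib _ _ T2) => [|[|[|]]].
Qed.

Lemma cap3 C : cap 3 C -> count C (points 3) <= 9.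
Proof.
move=> capC; apply: count_le_sub => S uS SP CS; apply/eqP => sS.
have := sum_squares uS SP zeros_ok3; rewrite sS => E.
(* Among sizes at most 4 with sum 10, the largest sum of squares is 36, from 4, 4, 2, while 13 * 36
   < 490. *)
suff : 490 <= size (functionals 3) * 36 by [].
rewrite -[490]/(10 * (13 + 10.-1 * 4)) -E; apply: leq_sum_seq_const => f fF.
have := sum_fib (dot f) S; rewrite sS !big_cons !big_nil.
have := fib_le _ capC CS uS SP hyperplane_ok3 fF cap2.
move=> H; move: (H T0) (H T1) (H T2).
case: (fib _ _ T0) => [|[|[|[|[|]]]]] //; case: (fib _ _ T1) => [|[|[|[|[|]]]]] //;
by case: (fib _ _ T2) => [|[|[|[|[|]]]]].
Qed.

(* For a hypothetical cap of size 21 the inequality becomes an equality after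
   summation over the 40 directions. The tight triples (7,7,7) and (9,9,3) have
   sums of squares 147 and 171, both 3 modulo 24, but the total of the sums of
   squares is 6300. *)
Lemma triple_ineq a b c : a <= 9 -> b <= 9 -> c <= 9 -> a + (b + (c + 0)) = 21 ->
  let s2 := a ^ 2 + (b ^ 2 + (c ^ 2 + 0)) in
  let s3 := a ^ 3 + (b ^ 3 + (c ^ 3 + 0)) in
  (19 * s2 <= s3 + 42 ^ 2) &&
  ((s3 + 42 ^ 2 - 19 * s2 == 0) ==> (24 %| s2 - 3) && (3 <= s2)).
Proof.
move=> la lb lc e /=.
pose chk := all (fun a => all (fun b => all (fun c =>
  (a + (b + (c + 0)) == 21) ==>
  let s2 := a ^ 2 + (b ^ 2 + (c ^ 2 + 0)) in
  let s3 := a ^ 3 + (b ^ 3 + (c ^ 3 + 0)) in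
  (19 * s2 <= s3 + 42 ^ 2) &&
  ((s3 + 42 ^ 2 - 19 * s2 == 0) ==> (24 %| s2 - 3) && (3 <= s2)))
  (iota 0 10)) (iota 0 10)) (iota 0 10).
have : chk by vm_compute.
have iota9 x : x <= 9 -> x \in iota 0 10 by rewrite mem_iota.
move/allP/(_ a (iota9 _ la))/allP/(_ b (iota9 _ lb))/allP/(_ c (iota9 _ lc)).
by rewrite e eqxx.
Qed.

(** Second moments alone do not exclude 21 points: (9,9,3) has sum of squares 171, and 40 * 171 >
    6300. The constants 19 and 42 ^ 2 are those for which s3 + 42 ^ 2 - 19 * s2 vanishes at both
    (7,7,7) and (9,9,3). *)
Lemma cap4 C : cap 4 C -> count C (points 4) <= 20.
Proof.
move=> capC; apply: count_le_sub => S uS SP CS; apply/eqP => sS.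
have := sum_squares uS SP zeros_ok4; rewrite sS.
have := sum_cubes uS SP zeros_ok4 capC CS zeros2_ok4; rewrite sS.
set F := functionals 4.
pose s2 f := \sum_(r <- trits) fib (dot f) S r ^ 2.
pose s3 f := \sum_(r <- trits) fib (dot f) S r ^ 3.
rewrite -/(\sum_(f <- F) s3 f) -/(\sum_(f <- F) s2 f) => E3 E2.
have ineq f : f \in F -> (19 * s2 f <= s3 f + 42 ^ 2) &&
  ((s3 f + 42 ^ 2 - 19 * s2 f == 0) ==> (24 %| s2 f - 3) && (3 <= s2 f)).
  move=> fF; have := sum_fib (dot f) S.
  rewrite /s2 /s3 sS !big_cons !big_nil.
  have H := fib_le _ capC CS uS SP hyperplane_ok4 fF cap3.
  exact: triple_ineq.
(* No slack is left: the totals 6300 and 49140 satisfy 19 * 6300 = 49140 + 40 * 42 ^ 2. *)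
have Z : \sum_(f <- F) (s3 f + 42 ^ 2 - 19 * s2 f) = 0.
  rewrite big_seq sumnB; last by move=> f /ineq/andP[].
  rewrite -!big_seq big_split /= sum_const -big_distrr /= E2 E3.
  by rewrite /F; vm_compute.
have D f : f \in F -> (24 %| s2 f - 3) && (3 <= s2 f).
  move=> fF; have /andP[_ /implyP] := ineq f fF; apply.
  by move/eqP: Z; rewrite sum_nat_seq_eq0 => /allP/(_ f fF).
(* Forty residues 3 add up to 0 modulo 24, but 6300 is 12 modulo 24. *)
have : 24 %| \sum_(f <- F) (s2 f - 3).
  rewrite big_seq; apply: (big_ind (fun x => 24 %| x)) => //.
    by move=> x y; apply: dvdn_add.
  by move=> f /D/andP[].
rewrite big_seq sumnB; last by move=> f /D/andP[].
by rewrite -!big_seq sum_const E2.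
Qed.

Definition cap_bound k := nth 0 [:: 1; 2; 4; 9; 20] k.

Lemma cap_count k C : k <= 4 -> cap k C -> count C (points k) <= cap_bound k.
Proof.
case: k => [|[|[|[|[|]]]]] //= _; first by case: (C _).
- exact: cap1.
- exact: cap2.
- exact: cap3.
- exact: cap4.
Qed.

(** * Linear programming certificates *)

Local Open Scope Z_scope.

(** A sparse linear form in unknowns y_p; the coefficient of y_p sits at the node reached by the
    path p. *)
Inductive trie := Lf | Nd of Z & trie & trie & trie.

Fixpoint tdot (t : trie) (y : point -> Z) : Z :=
  match t with
  | Lf => 0
  | Nd z a b c => z * y [::] + (tdot a (fun p => y (T0 :: p)) +
      (tdot b (fun p => y (T1 :: p)) + tdot c (fun p => y (T2 :: p))))
  end.

Fixpoint tput (p : point) (v : Z) (t : trie) : trie :=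
  let: (z, a, b, c) := if t is Nd z a b c then (z, a, b, c)
                       else (0, Lf, Lf, Lf) in
  match p with
  | [::] => Nd (z + v) a b c
  | T0 :: q => Nd z (tput q v a) b c
  | T1 :: q => Nd z a (tput q v b) c
  | T2 :: q => Nd z a b (tput q v c)
  end.

Fixpoint tget (p : point) (t : trie) : Z :=
  if t is Nd z a b c then
    match p with
    | [::] => z
    | T0 :: q => tget q a
    | T1 :: q => tget q b
    | T2 :: q => tget q c
    end
  else 0.

(** The maximum of the form over unknowns in [0, 1]. It supplies the best dual multipliers for y_p
    <= 1, so certificates need not list them. *)
Fixpoint tpos (t : trie) : Z :=
  if t is Nd z a b c then Z.max 0 z + (tpos a + (tpos b + tpos c)) else 0.

Lemma tdot_put p v t y : tdot (tput p v t) y = tdot t y + v * y p.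
Proof.
elim: p t y => [|[] p IH] [|z a b c] y /=; rewrite ?IH /=; lia.
Qed.

Lemma tdot_le_pos t y : (forall p, 0 <= y p <= 1) -> tdot t y <= tpos t.
Proof.
elim: t y => [|z a IHa b IHb c IHc] y Hy /=; first by lia.
have := IHa _ (fun p => Hy (T0 :: p)); have := IHb _ (fun p => Hy (T1 :: p)).
have := IHc _ (fun p => Hy (T2 :: p)); have := Hy [::]; nia.
Qed.

Definition zsum (T : Type) (s : seq T) (f : T -> Z) : Z :=
  foldr (fun x a => f x + a) 0 s.

Lemma tdot_puts (s : seq point) (w : point -> Z) t y :
  tdot (foldr (fun p => tput p (w p)) t s) y =
  tdot t y + zsum s (fun p => w p * y p).
Proof. by elim: s => [|p s IH] /=; [lia | rewrite tdot_put IH; lia]. Qed.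

(** The rank in [points 4] reads the coordinates as base 3 digits, the first one most significant:
    27, 9, 3, 1 are the unit vectors, which belong to the primes 2, 3, 5, 7. *)
Definition decode (i : Z) : point := nth [::] (points 4) (Z.to_nat i).

(* [Leaf D cs] proves sum_p w p y_p < t by adding up the inequalities
   m * (sum_(p in flat o ds) y_p <= cap_bound (size ds)) listed as
   (m, o :: ds) in cs, with D a common denominator; [Branch p c0 c1] splits
   into the cases y_p = 0 and y_p = 1. *)
Inductive cert :=
| Leaf of Z & seq (Z * seq Z)
| Branch of Z & cert & cert.

(** Invariant of the state (ok, t, b): D times the weight of the cap is at most t(y) + b. A
    constraint adds the nonnegative quantity m * (bound - sum of y over the flat) to the right
    side. *)
Definition use_constraint (c : Z * seq Z) (st : bool * trie * Z) :=
  let: (ok, t, b) := st in let: (m, l) := c in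
  if [seq decode i | i <- l] is o :: ds then
    let s := flat o ds in
    ([&& ok, 0 <=? m, (size ds <= 4)%N, all (fun d => size d == 4%N) (o :: ds)
       & uniq s],
     foldr (fun p => tput p (- m)) t s, b + m * Z.of_nat (cap_bound (size ds)))
  else (false, t, b).

(** Eliminates y_p, whose value v is fixed on the current branch, by moving its term into the
    constant. *)
Definition use_value (e : point * Z) (st : trie * Z) :=
  let: (t, b) := st in let: (p, v) := e in
  let r := tget p t in (tput p (- r) t, b + r * v).

Definition check_leaf (w : point -> Z) target D cs ctx :=
  let: (ok, t1, b1) := foldr use_constraint
    (true, foldr (fun p => tput p (D * w p)) Lf (points 4), 0) cs in
  let: (t2, b2) := foldr use_value (t1, b1) ctx in
  [&& ok, 0 <? D & b2 + tpos t2 <? D * target].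

Fixpoint check (w : point -> Z) target (c : cert) (ctx : seq (point * Z)) :=
  match c with
  | Leaf D cs => check_leaf w target D cs ctx
  | Branch i c0 c1 => check w target c0 ((decode i, 0) :: ctx) &&
                      check w target c1 ((decode i, 1) :: ctx)
  end.

Definition indicator (C : pred point) p : Z := if C p then 1 else 0.

Section Soundness.
Variables (w : point -> Z) (target : Z) (C : pred point).
Hypothesis capC : cap 4 C.
Local Notation y := (indicator C).

Lemma zsum_indicator s m :
  zsum s (fun p => m * y p) = m * Z.of_nat (count C s).
Proof.
elim: s => [|p s IH] /=; first by lia.
by rewrite IH /indicator; case: (C p); lia.
Qed.

Lemma use_constraint_sound W c ok t b ok' t' b' :
  use_constraint c (ok, t, b) = (ok', t', b') -> ok' ->
  ok /\ (W <= tdot t y + b -> W <= tdot t' y + b').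
Proof.
case: c => m l; rewrite /use_constraint; case: map => [|o ds]; first by case=> <-.
move=> [<- <- <-] /and5P[-> m0 sds sz us]; split=> // H.
rewrite tdot_puts (zsum_indicator _ (- m)).
have /leP/inj_le le : (count C (flat o ds) <= cap_bound (size ds))%N.
  by apply: (count_flat capC sz us) => C'; apply: cap_count.
by move/Z.leb_le in m0; nia.
Qed.

Lemma use_constraints_sound W cs ok t b ok' t' b' :
  foldr use_constraint (ok, t, b) cs = (ok', t', b') -> ok' ->
  W <= tdot t y + b -> W <= tdot t' y + b'.
Proof.
elim: cs ok' t' b' => [|c cs IH] ok' t' b' /=; first by move=> [_ <- <-].
case E: (foldr _ _ _) => [[ok1 t1] b1] E' ok'T le.
have [ok1T] := use_constraint_sound W E' ok'T; apply.
exact: IH E ok1T le.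
Qed.

Fixpoint holds (ctx : seq (point * Z)) : Prop :=
  if ctx is e :: ctx' then y e.1 = e.2 /\ holds ctx' else True.

Lemma use_values_sound W ctx t b t' b' : holds ctx ->
  foldr use_value (t, b) ctx = (t', b') ->
  W <= tdot t y + b -> W <= tdot t' y + b'.
Proof.
elim: ctx t' b' => [|[p v] ctx IH] t' b' /=; first by move=> _ [<- <-].
case E: (foldr _ _ _) => [t1 b1] [Hp Hy] [<- <-] le.
by rewrite tdot_put Hp; have := IH _ _ Hy E le; lia.
Qed.

Lemma check_sound c ctx : holds ctx ->
  check w target c ctx -> zsum (points 4) (fun p => w p * y p) < target.
Proof.
elim: c ctx => [D cs|i c0 IH0 c1 IH1] ctx Hy; last first.
  case/andP; case Cp: (C (decode i)).
    by move=> _; apply: IH1; rewrite /= /indicator Cp.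
  by move=> + _; apply: IH0; rewrite /= /indicator Cp.
rewrite [check _ _ _ _]/= /check_leaf.
case E: (foldr use_constraint _ _) => [[ok t1] b1].
case E': (foldr use_value _ _) => [t2 b2] /and3P[okT /Z.ltb_lt D0 /Z.ltb_lt lt].
pose W := zsum (points 4) (fun p => w p * y p); rewrite -/W.
have H0 : D * W <= tdot (foldr (fun p => tput p (D * w p)) Lf (points 4)) y + 0.
  rewrite (tdot_puts _ (fun p => D * w p)) /W.
  suff -> : forall s, zsum s (fun p => D * w p * y p) =
                      D * zsum s (fun p => w p * y p).
    by rewrite Z.add_0_r; apply: Z.le_refl.
  by elim=> [|p s /= ->]; [rewrite /=; lia | rewrite Z.mul_add_distr_l Z.mul_assoc].
clearbody W; have le1 := use_values_sound Hy E' (use_constraints_sound E okT H0).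
have le2 : tdot t2 y <= tpos t2.
  by apply: tdot_le_pos => p; rewrite /indicator; case: (C p).
clear - D0 lt le1 le2; apply/(Z.mul_lt_mono_pos_l _ _ _ D0).
lia.
Qed.
End Soundness.

(** * Weights of points and certificates for the modulus 210 *)

Definition trit_nat x : nat := match x with T0 => 0 | T1 => 1 | T2 => 2 end.

Fixpoint zrep (ps : seq Z) (p : point) : Z :=
  match ps, p with
  | q :: ps', x :: p' =>
    match x with T0 => 1 | T1 => q | T2 => q * q end * zrep ps' p'
  | _, _ => 1
  end.

Definition zprimes := [:: 2; 3; 5; 7].

Definition weight (x : Z) (p : point) : Z :=
  let r := zrep zprimes p in
  (if r <=? x then 1 else 0) + (if 8 * r <=? x then 1 else 0).

(* In the g-th entry (j, c), c certifies that no cap has weight g at j - 1, where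
   points are numbered in base 3. The multipliers come from rounded optimal
   solutions of the dual linear programs. *)
Definition certs : seq (Z * cert) := [::
(1, Leaf 1 [:: ]);
(2, Leaf 1 [:: ]);
(3, Leaf 1 [:: ]);
(5, Leaf 1 [:: (1,[::0;27])]);
(6, Leaf 1 [:: (1,[::0;27])]);
(7, Leaf 1 [:: (1,[::0;9;27])]);
(8, Leaf 1 [:: (1,[::0;9;27])]);
(10, Leaf 1 [:: (1,[::0;9]); (1,[::0;27])]);
(14, Leaf 1 [:: (1,[::0;9;27])]);
(15, Leaf 1 [:: (1,[::0;9;27])]);
(16, Leaf 1 [:: (1,[::0;9;27])]);
(21, Leaf 2 [:: (2,[::0;9;27]); (1,[::1;5;27]); (1,[::0;3;27]); (1,[::0;1;27])]);
(24, Leaf 2 [:: (2,[::0;9;27]); (1,[::1;5;27]); (1,[::0;3;27]); (1,[::0;1;27])]);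
(30, Leaf 1 [:: (1,[::1;27]); (1,[::0;9;27]); (1,[::0;3;27])]);
(35, Leaf 1 [:: (1,[::0;9;27]); (1,[::0;3;27]); (1,[::1;14;27])]);
(40, Leaf 1 [:: (1,[::0;9;27]); (1,[::0;3;27]); (1,[::1;14;27])]);
(42, Leaf 1 [:: (1,[::0;9;27]); (1,[::0;3;27]); (1,[::1;14;27])]);
(48, Leaf 1 [:: (1,[::0;9;27]); (1,[::0;3;27]); (1,[::3;9]); (1,[::1;9;27])]);
(56, Leaf 11 [:: (8,[::0;3;27]); (7,[::0;9;27]); (6,[::3;9]); (4,[::0;1;27]); (3,[::3;15;30]);
(3,[::3;9;27]); (2,[::2;10;28]); (2,[::0;1;9]); (4,[::1;27]); (2,[::2;5;38]); (5,[::9;1;27]);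
(1,[::1;11;27]); (1,[::0;3;9]); (1,[::3;9;34]); (1,[::2;11;29]); (1,[::27;1;9])]);
(60, Leaf 3 [:: (2,[::0;3;27]); (2,[::0;9;27]); (2,[::3;9]); (1,[::0;1;27]); (1,[::0;1;9]);
(2,[::1;27]); (1,[::3;15;30]); (1,[::2;5;38]); (1,[::3;9;27]); (2,[::9;1;27])]);
(70, Leaf 4 [:: (3,[::0;9;27]); (2,[::3;9;27]); (2,[::0;1;27]); (2,[::1;9;27]); (2,[::0;1;3]);
(2,[::3;30]); (3,[::9;27]); (1,[::0;3;9;27]); (1,[::0;3;27]); (1,[::1;9;29]); (1,[::9;3;27])]);
(80, Leaf 4 [:: (2,[::0;9;27]); (2,[::0;3;9;27]); (1,[::0;1;9]); (1,[::0;1;27]);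
(1,[::3;12;30]); (1,[::3;9;27]); (1,[::0;3;27]); (1,[::0;3;9]); (1,[::1;3;27]); (1,[::1;9;27]);
(1,[::2;10;28]); (1,[::2;11;29]); (1,[::1;9;29]); (1,[::4;17;27])]);
(98, Leaf 6 [:: (6,[::0;9;27]); (5,[::1;9;27]); (3,[::0;3;9;27]); (2,[::3;9;27]); (2,[::2;5]);
(1,[::0;1;3]); (1,[::3;12;30]); (1,[::3;12]); (1,[::3;9]); (1,[::3;12;33]); (1,[::2;10]);
(1,[::0;1;27]); (1,[::9;27]); (1,[::0;1;30]); (1,[::1;3;29]); (1,[::1;5;28]); (1,[::3;1;27]);
(1,[::9;1;27])]);
(105, Leaf 1 [:: (1,[::0;1;9;27]); (1,[::0;3;9;27]); (1,[::3;1;27])]);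
(120, Leaf 12 [:: (12,[::1;9;27]); (8,[::0;9;27]); (8,[::9;27]); (6,[::3;9;27]);
(6,[::0;3;9;27]); (6,[::3;12]); (5,[::27;1;3]); (4,[::0;1;30]); (3,[::2;5;29]); (3,[::0;1;3]);
(2,[::3;1;33]); (2,[::1;28]); (1,[::1;5;28]); (2,[::0;1;27]); (1,[::4;17;27]); (1,[::8;17;35]);
(1,[::18;36]); (1,[::0;4;9])]);
(140, Leaf 4 [:: (4,[::1;9;27]); (3,[::9;27]); (2,[::0;9;27]); (2,[::3;9;27]); (2,[::0;3;9;27]);
(1,[::3;12]); (2,[::0;1;30]); (1,[::27;1;3]); (1,[::0;1;27]); (1,[::1;5;28]); (1,[::3;1;33]);
(1,[::0;3;9]); (1,[::18;36]); (1,[::6;15;33]); (1,[::2;29])]);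
(168, Leaf 1 [:: (1,[::0;3;9;27]); (1,[::0;1;9;27]); (1,[::3;1;27])]);
(200, Leaf 1 [:: (1,[::3;27]); (1,[::0;3;9;27]); (1,[::1;3;27]); (1,[::0;1;9;27])]);
(210, Leaf 1 [:: (1,[::0;3;9;27]); (1,[::1;3;27]); (1,[::0;1;9;27]); (1,[::3;27]);
(1,[::6;15])]);
(240, Leaf 1 [:: (1,[::0;3;9;27]); (1,[::1;3;27]); (1,[::0;1;9;27]); (1,[::3;10;27]);
(1,[::6;15])]);
(280, Leaf 10 [:: (9,[::0;3;9;27]); (7,[::0;1;9;27]); (5,[::3;1;27]); (5,[::12;1;27]);
(3,[::1;12;27]); (2,[::6;15]); (2,[::0;1;3]); (2,[::1;3;27]); (2,[::1;9;27]); (2,[::6;1;30]);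
(2,[::1;4]); (1,[::3;9;27]); (2,[::10;45]); (1,[::6;1;33]); (1,[::9;1;27]); (1,[::9;1;36]);
(1,[::9;3;27]); (1,[::11;37]); (1,[::27;9]); (1,[::0;9;27]); (1,[::7;33]); (1,[::0;1;3;27]);
(1,[::3;15;27]); (1,[::6;1;15]); (1,[::6;9;33]); (1,[::1;5;27])]);
(392, Branch 18
(Branch 72
(Branch 21
(Branch 3
(Branch 55
(Leaf 31 [:: (25,[::0;3;9;27]); (20,[::4;9]); (16,[::9;1;27]); (21,[::12;27]); (11,[::1;9;27]);
(10,[::0;1;3;27]); (9,[::0;10;28]); (9,[::1;3;9]); (8,[::0;1;9;27]); (7,[::1;3;27]);
(6,[::6;30]); (6,[::28;3;9]); (6,[::27;1;9]); (6,[::3;1;27]); (6,[::1;4;28]); (6,[::9;1;30]);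
(5,[::9;3;36]); (5,[::0;1;3]); (5,[::2;5;29]); (3,[::0;12;30]); (5,[::12;36]); (2,[::6;33]);
(2,[::27;3;9]); (2,[::1;9;29]); (2,[::5;10;28]); (2,[::2;14;35]); (2,[::1;4;29]); (1,[::0;1;9]);
(1,[::1;11;28]); (1,[::6;9;30])])
(Leaf 27 [:: (23,[::1;9;27]); (21,[::0;3;9;27]); (12,[::4;9]); (16,[::9;1;27]);
(13,[::0;1;3;27]); (12,[::2;5;28]); (8,[::1;3;27]); (10,[::9;1;36]); (6,[::5;10;28]);
(6,[::0;5;29]); (5,[::6;33]); (6,[::12;27]); (5,[::0;12;30]); (4,[::12;1;33]); (6,[::1;14;27]);
(5,[::0;11;29]); (1,[::29;11]); (2,[::0;1;9;27]); (2,[::9;3;36]); (6,[::4;9;35]);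
(2,[::9;3;27]); (2,[::1;4]); (2,[::0;10;28]); (3,[::4;9;29]); (3,[::36;1;3]); (1,[::6;9;33]);
(1,[::12;1;27]); (1,[::9;1;3])]))
(Leaf 22 [:: (22,[::0;3;9;27]); (14,[::3;1;9]); (14,[::1;9;27]); (14,[::9;1;27]);
(12,[::1;3;27]); (8,[::29;11]); (8,[::0;1;9;27]); (6,[::10;38]); (6,[::0;3;27]);
(6,[::0;1;3;27]); (2,[::6;33]); (2,[::2;5;28]); (2,[::4;9;27]); (5,[::3;9;27]); (2,[::0;3;28]);
(2,[::0;1;3]); (2,[::22;45]); (2,[::2;4]); (4,[::4;9]); (1,[::3;10;27]); (1,[::12;1;27]);
(2,[::2;5;11]); (2,[::1;5;27])]))
(Leaf 840 [:: (743,[::21;45]); (719,[::0;3;9;27]); (644,[::3;1;9]); (619,[::1;3;27]);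
(439,[::0;1;9;27]); (264,[::6;33]); (469,[::10;27]); (224,[::6;12]); (212,[::1;9;27]);
(191,[::2;5]); (176,[::9;1;27]); (139,[::0;1;27]); (121,[::3;9;33]); (85,[::5;11]);
(84,[::0;11;29]); (83,[::3;9;27]); (80,[::6;1;12]); (73,[::27;1;9]); (71,[::1;3;9;27]);
(70,[::0;1;3;27]); (65,[::0;15;33]); (65,[::0;12;30]); (62,[::36;1]); (61,[::1;10;29]);
(57,[::0;10;28]); (401,[::21;36]); (45,[::4;15;30]); (42,[::0;3;9]); (40,[::6;34]);
(40,[::4;9;27]); (35,[::1;4;28]); (34,[::1;9;29]); (33,[::36;1;3]); (24,[::27;3;9]);
(14,[::6;9;33]); (5,[::5;10;28]); (1,[::2;11;28])]))
(Branch 21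
(Leaf 18 [:: (18,[::6;42]); (15,[::0;3;9;27]); (14,[::0;1;9;27]); (11,[::1;3;27]); (1,[::3;27]);
(6,[::4;9]); (5,[::3;1;9]); (4,[::0;9;27]); (4,[::1;3;9]); (4,[::1;9;27]); (3,[::3;1;27]);
(8,[::12;48]); (2,[::5;10]); (4,[::4;15;30]); (1,[::5;29]); (4,[::3;16;27]); (3,[::5;17]);
(2,[::15;51]); (2,[::3;9;27]); (3,[::0;1;3;27]); (2,[::9;1;27]); (2,[::28;5;10]); (2,[::12;36]);
(1,[::5;10;28]); (2,[::8;12;32]); (3,[::3;10;27]); (1,[::2;11;27]); (1,[::9;3;27])])
(Leaf 28 [:: (25,[::1;3;27]); (24,[::0;3;9;27]); (23,[::3;1;9]); (17,[::6;12;30]);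
(15,[::0;1;9;27]); (10,[::6;33]); (10,[::1;9;27]); (9,[::21;45]); (20,[::2;38]); (9,[::0;36]);
(4,[::2;11;27]); (4,[::0;15;30]); (6,[::8;14;30]); (6,[::10;38]); (4,[::3;9;27]); (1,[::11;29]);
(3,[::3;9;30]); (3,[::1;10;27]); (3,[::6;1;12]); (3,[::5;11]); (3,[::4;15;30]); (3,[::0;10;28]);
(3,[::1;9;28]); (2,[::4;16;29]); (9,[::21;36]); (2,[::6;42]); (2,[::4;9;27]); (1,[::3;1;27]);
(4,[::9;1;27]); (1,[::0;12;33]); (1,[::0;12;30])])))
(Branch 57
(Leaf 46 [:: (44,[::1;3;27]); (39,[::0;3;9;27]); (33,[::0;1;9;27]); (32,[::3;1;9]);
(14,[::6;33]); (12,[::1;9;27]); (7,[::18;48]); (7,[::0;3;9]); (13,[::6;15]); (20,[::18;46]);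
(5,[::18;39]); (8,[::2;11;27]); (29,[::2;11]); (7,[::3;1;36]); (6,[::9;1;27]); (2,[::18;3;36]);
(5,[::0;9;27]); (8,[::4;9;29]); (3,[::18;36]); (4,[::27;3;9]); (7,[::6;42]); (3,[::36;1;3]);
(5,[::5;11]); (7,[::0;3;37]); (5,[::21;36]); (2,[::6;1;12]); (2,[::27;1;9]); (2,[::6;14]);
(1,[::1;4;10]); (2,[::2;11;28]); (1,[::4;9;27]); (1,[::1;4;28]); (1,[::0;11;29]);
(1,[::1;10;29]); (1,[::27;1;3])])
(Branch 27
(Leaf 11 [:: (11,[::6;15]); (11,[::21;45]); (11,[::4;9]); (9,[::0;3;9;27]); (8,[::1;3;27]);
(7,[::0;1;9;27]); (6,[::3;27]); (4,[::1;9;27]); (8,[::18;46]); (6,[::2;11]); (3,[::0;9;27]);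
(3,[::9;1;27]); (3,[::3;1]); (2,[::1;4;28]); (2,[::0;5;29]); (2,[::3;9;27]); (2,[::3;12;27]);
(2,[::5;17]); (1,[::1;10;27]); (1,[::2;3;29]); (1,[::0;5;28])])
(Leaf 29 [:: (25,[::21;45]); (20,[::0;3;9;27]); (18,[::1;3;27]); (18,[::0;1;9;27]);
(9,[::6;13;30]); (11,[::0;9;27]); (10,[::3;1;9]); (16,[::6;30]); (9,[::4;9]); (7,[::1;9;27]);
(6,[::3;9;27]); (6,[::18;39]); (6,[::3;1;27]); (6,[::2;5;28]); (4,[::18;46]); (5,[::27;1;9]);
(5,[::0;1;3;27]); (4,[::9;3;45]); (4,[::9;1;3]); (4,[::1;3;9]); (4,[::18;36]); (2,[::18;48]);
(3,[::1;10;27]); (3,[::18;51]); (4,[::5;10;34]); (10,[::3;16;27]); (3,[::1;10;29]);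
(3,[::0;12;27]); (3,[::6;15;30]); (2,[::0;5;10]); (2,[::5;17]); (2,[::18;3;45]);
(2,[::12;1;33]); (1,[::9;1;45]); (1,[::3;12;27]); (1,[::2;11]); (1,[::18;5;47])]))));
(480, Branch 6
(Branch 5
(Branch 55
(Branch 57
(Branch 33
(Leaf 16 [:: (13,[::0;1;9;27]); (13,[::0;3;9;27]); (1,[::3;9]); (11,[::1;3;27]); (5,[::4;9;27]);
(4,[::0;1;9]); (1,[::13;27]); (10,[::3;9;27]); (3,[::2;16;31]); (3,[::3;9;33]); (5,[::10;3;27]);
(2,[::2;11]); (2,[::9;1;27]); (2,[::0;1;27]); (2,[::2;52]); (2,[::4;16;29]); (2,[::2;5;38]);
(5,[::3;1;9]); (2,[::7;12]); (2,[::1;3;36]); (1,[::27;3;9]); (1,[::7;12;35]); (1,[::28;5;10]);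
(1,[::2;9;29]); (3,[::2;29]); (1,[::10;45]); (2,[::4;15;30]); (1,[::19;4;37]); (2,[::19;42])])
(Leaf 39 [:: (39,[::0;3;9;27]); (30,[::33;15]); (23,[::27;1;3]); (23,[::4;32]); (18,[::0;1;9]);
(13,[::0;1;36]); (13,[::9;1;27]); (13,[::2;11]); (13,[::20;43]); (13,[::2;29]); (12,[::4;9;27]);
(13,[::2;34]); (12,[::3;9;34]); (13,[::1;3]); (18,[::3;9;30]); (8,[::1;3;29]); (8,[::0;1;9;27]);
(8,[::29;4]); (6,[::7;12;30]); (5,[::36;1]); (5,[::1;3;9;27]); (1,[::13;27]); (4,[::1;3;9]);
(4,[::1;9;27]); (7,[::28;9]); (3,[::1;3;36]); (7,[::10;3;27]); (9,[::3;1;9]); (2,[::1;15;33]);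
(1,[::33;1;15]); (1,[::22;45])]))
(Branch 27
(Leaf 47 [:: (42,[::0;3;9;27]); (23,[::3;27]); (34,[::4;9;27]); (16,[::21;45]); (32,[::2;35]);
(21,[::0;1;9;27]); (19,[::9;1;27]); (17,[::28;9]); (15,[::1;3]); (13,[::2;11;27]);
(13,[::0;4;28]); (13,[::1;3;9]); (13,[::20;43]); (12,[::12;48]); (11,[::1;3;27]);
(28,[::3;9;27]); (8,[::1;9;27]); (7,[::2;11;29]); (7,[::0;15;33]); (7,[::1;11;28]);
(6,[::2;29]); (5,[::0;1;9]); (5,[::1;3;36]); (4,[::0;12;33]); (4,[::1;14;28]); (4,[::28;10]);
(4,[::2;11]); (3,[::10;5;28]); (2,[::1;3;28]); (2,[::0;1;33]); (2,[::2;3;29]); (1,[::2;9;29]);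
(1,[::33;15]); (1,[::3;9;30]); (1,[::18;3;45]); (1,[::1;10;32])])
(Leaf 20 [:: (20,[::2;35]); (20,[::4;9;27]); (18,[::0;3;9;27]); (14,[::0;1;9;27]); (13,[::1;3]);
(2,[::21;45]); (6,[::0;3;27]); (7,[::12;48]); (7,[::8;14;32]); (6,[::1;3;29]); (2,[::27;1]);
(8,[::28;9]); (8,[::3;9;27]); (1,[::3;16;27]); (2,[::33;15]); (4,[::27;1;9]); (2,[::2;11]);
(2,[::9;1;27]); (8,[::10;27]); (3,[::0;1;9]); (1,[::20;38]); (2,[::6;15;30]); (3,[::3;9]);
(3,[::1;9;27]); (1,[::1;3;11]); (1,[::2;9;29]); (1,[::3;15;30]); (1,[::3;15;27]);
(1,[::3;9;33]); (1,[::3;12;33])])))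
(Branch 7
(Branch 1
(Leaf 420 [:: (420,[::4;30]); (373,[::0;3;9;27]); (366,[::3;9;27]); (356,[::4;9;27]);
(317,[::0;1;9;27]); (133,[::2;11]); (120,[::2;29]); (106,[::2;38]); (71,[::9;1;27]);
(61,[::2;28]); (224,[::1;9;27]); (47,[::0;33]); (47,[::27;3;9]); (74,[::3;9;34]); (32,[::2;34]);
(32,[::20;5;36]); (32,[::0;10;28]); (32,[::9;1]); (32,[::2;5;27]); (27,[::0;15;33]);
(22,[::0;1;27]); (20,[::33;15]); (20,[::1;11;27]); (20,[::9;3;45]); (17,[::2;11;27]);
(15,[::0;10;30]); (32,[::4;9;33]); (32,[::13;27]); (7,[::0;12;33]); (7,[::3;15;30]);
(20,[::3;27]); (5,[::20;46])])
(Leaf 44 [:: (44,[::1;27]); (41,[::4;30]); (40,[::4;9;27]); (37,[::0;3;9;27]); (36,[::3;9;27]);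
(18,[::9;1;27]); (18,[::0;1;9;27]); (17,[::2;28]); (17,[::1;9;27]); (11,[::33;15]);
(10,[::2;11;27]); (9,[::2;11]); (8,[::10;36]); (8,[::1;11;28]); (8,[::0;1]); (7,[::18;1;45]);
(7,[::3;9;30]); (7,[::2;38]); (7,[::0;1;9]); (6,[::27;3]); (5,[::0;12;33]); (4,[::0;15;33]);
(4,[::0;3;27]); (4,[::0;1;27]); (4,[::21;39]); (3,[::2;5;27]); (3,[::1;12;27]); (2,[::12;48]);
(2,[::3;1;30]); (2,[::1;5;27]); (2,[::2;16;31]); (1,[::2;5;9]); (1,[::12;33]); (1,[::20;46]);
(1,[::20;5;36]); (1,[::2;3;28]); (1,[::0;1;36]); (1,[::4;15;30])]))
(Leaf 38 [:: (38,[::0;3;9;27]); (36,[::13;27]); (34,[::7;12]); (27,[::1;3;27]);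
(25,[::0;1;9;27]); (22,[::3;9;27]); (20,[::1;3]); (13,[::7;17]); (25,[::4;30]); (12,[::2;4]);
(11,[::7;35]); (9,[::0;5;29]); (9,[::33;15]); (9,[::7;13;29]); (7,[::2;38]); (6,[::28;9]);
(6,[::2;28]); (6,[::2;11;29]); (5,[::2;3;28]); (4,[::9;1;27]); (4,[::2;4;29]); (3,[::2;10;29]);
(3,[::0;9;29]); (9,[::19;45]); (3,[::36;1]); (3,[::2;13;34]); (7,[::21;45]); (2,[::2;11]);
(2,[::1;9;27]); (2,[::2;10;28]); (2,[::7;12;33]); (2,[::1;3;36]); (2,[::4;9;33]);
(1,[::2;11;27]); (1,[::0;9;28])])))
(Branch 69
(Branch 2
(Leaf 19 [:: (19,[::0;3;9;27]); (16,[::5;10]); (16,[::21;45]); (15,[::0;1;9;27]); (14,[::3;1]);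
(15,[::10;3;27]); (12,[::1;3;27]); (5,[::5;31]); (12,[::5;28]); (2,[::13;27]); (4,[::27;1;3]);
(2,[::28;9]); (3,[::3;1;30]); (3,[::1;3]); (2,[::33;15]); (2,[::0;1;9]); (2,[::3;1;27]);
(2,[::12;48]); (1,[::21;39]); (1,[::1;3;29]); (1,[::1;3;36]); (2,[::1;9;27]); (1,[::0;9;27]);
(1,[::9;1;27]); (1,[::1;10;27]); (1,[::1;3;9]); (1,[::8;14;32]); (2,[::36;1]); (1,[::0;5;10]);
(1,[::4;9;27]); (1,[::20;4;38])])
(Leaf 18 [:: (18,[::2;3;29]); (17,[::0;1;9;27]); (17,[::2;3;11]); (13,[::0;1;3]);
(13,[::2;3;28]); (17,[::3;1]); (11,[::2;52]); (8,[::5;10]); (9,[::9;3;27]); (11,[::2;3;38]);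
(8,[::3;9;27]); (6,[::2;38]); (6,[::27;3;9]); (6,[::5;31]); (5,[::33;15]); (5,[::2;3;10]);
(4,[::0;15;33]); (3,[::21;45]); (4,[::5;46]); (5,[::5;10;28]); (4,[::1;3]); (2,[::30;12]);
(2,[::9;27]); (2,[::21;39]); (1,[::9;4;27]); (1,[::3;15;27]); (1,[::2;11]); (1,[::6;12;33]);
(1,[::12;48]); (1,[::2;11;27]); (1,[::28;9]); (1,[::4;10;28])]))
(Branch 55
(Leaf 20 [:: (17,[::3;1]); (12,[::2;3;29]); (12,[::5;28]); (12,[::1;3]); (11,[::0;3;9;27]);
(10,[::5;10]); (9,[::9;30]); (8,[::18;3;36]); (8,[::0;1;3;9;27]); (6,[::0;1;9;27]);
(5,[::2;11;27]); (5,[::21;42]); (5,[::12;33]); (8,[::10;3;27]); (4,[::0;1;36]); (4,[::0;12;33]);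
(3,[::0;15;33]); (2,[::0;1;9]); (2,[::2;9;29]); (2,[::33;15]); (5,[::1;9;27]); (1,[::20;4;38]);
(2,[::9;1;30]); (1,[::5;17]); (1,[::3;15;30]); (2,[::3;1;9]); (1,[::27;3;9]); (1,[::27;1;9]);
(2,[::1;12;27]); (1,[::0;10;28]); (1,[::0;1;3]); (1,[::4;15;32]); (1,[::8;14;32]);
(1,[::9;5;28])])
(Leaf 3 [:: (3,[::0;3;9;27]); (2,[::5;31]); (2,[::0;1;9;27]); (3,[::4;30]); (2,[::1;12;27]);
(1,[::5;10]); (1,[::1;9;27]); (1,[::7;12;33]); (1,[::0;1;3]); (1,[::7;17;33]); (1,[::11;32]);
(1,[::2;11;27]); (1,[::2;3;28]); (1,[::3;1;9]); (2,[::19;5;45]); (1,[::5;17;28]); (1,[::2;29]);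
(1,[::3;1;27]); (1,[::9;30])]))))
(Branch 33
(Branch 12
(Branch 4
(Leaf 17 [:: (14,[::0;3;9;27]); (8,[::13;27]); (8,[::1;9;27]); (6,[::21;45]); (8,[::0;1;9;27]);
(8,[::6;42]); (7,[::28;3]); (5,[::6;1;12]); (5,[::2;11;28]); (5,[::0;1;3;27]); (4,[::1;11;27]);
(4,[::1;4;28]); (4,[::2;11;27]); (4,[::22;36]); (4,[::0;1;3]); (5,[::3;10;27]); (3,[::36;1]);
(3,[::0;3;45]); (3,[::5;28]); (4,[::21;1;45]); (2,[::2;5;9]); (2,[::6;12;33]); (2,[::6;39]);
(2,[::2;9;28]); (1,[::2;3;11]); (1,[::2;4;11]); (1,[::2;4]); (1,[::6;12]); (1,[::0;3;36]);
(1,[::1;3;27]); (1,[::2;11]); (1,[::28;10]); (1,[::6;16;33]); (1,[::19;5;45]); (1,[::3;36])])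
(Leaf 3 [:: (3,[::0;3;9;27]); (2,[::2;5]); (2,[::0;1;9;27]); (2,[::21;45]); (2,[::4;9;27]);
(2,[::4;30]); (2,[::6;33]); (1,[::3;1]); (1,[::1;3;27]); (1,[::1;9;27]); (1,[::0;1;3]);
(1,[::6;1;12]); (1,[::27;1;9]); (1,[::1;4]); (1,[::18;46]); (1,[::20;38]); (1,[::2;5;38]);
(1,[::3;10;27])]))
(Branch 1
(Branch 3
(Leaf 42 [:: (37,[::0;3;9;27]); (29,[::2;5]); (24,[::13;27]); (24,[::6;15]); (16,[::6;33]);
(16,[::0;10;28]); (15,[::2;5;28]); (15,[::6;1;12]); (11,[::6;42]); (13,[::0;1;9;27]);
(12,[::1;9;27]); (12,[::1;3;27]); (12,[::27;1;9]); (11,[::5;28]); (20,[::21;45]);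
(11,[::2;5;38]); (8,[::9;1;27]); (8,[::28;3]); (7,[::4;9;27]); (6,[::6;12]); (6,[::0;1;3;27]);
(5,[::5;10;28]); (5,[::5;10;29]); (5,[::5;11]); (5,[::0;10;29]); (4,[::5;10]); (4,[::6;15;33]);
(4,[::0;5;10]); (4,[::9;3;27]); (14,[::19;45]); (3,[::6;1;33]); (3,[::2;9;29]); (3,[::2;11;27]);
(5,[::10;3;27]); (2,[::0;11;29]); (2,[::2;5;11]); (1,[::0;1;3;9;27]); (1,[::2;5;29])])
(Leaf 240 [:: (213,[::0;3;9;27]); (191,[::3;9]); (172,[::2;5]); (164,[::6;42]); (136,[::6;15]);
(125,[::5;10]); (96,[::13;27]); (105,[::19;45]); (79,[::0;1;3;27]); (76,[::3;9;27]);
(72,[::7;12;30]); (70,[::0;1;9;27]); (69,[::9;1;27]); (72,[::6;16]); (57,[::27;1;9]);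
(53,[::1;3;27]); (61,[::2;5;11]); (44,[::0;10;28]); (40,[::2;5;28]); (40,[::6;33]);
(47,[::10;3;27]); (36,[::7;12;33]); (36,[::0;3;28]); (34,[::29;11]); (33,[::1;9;27]);
(33,[::2;9;29]); (32,[::4;12;30]); (33,[::9;1]); (30,[::9;36]); (29,[::3;1;27]);
(27,[::9;3;27]); (24,[::3;15;27]); (38,[::0;3]); (21,[::2;9;28]); (11,[::9;1;36]);
(18,[::3;10;27]); (7,[::4;9;27]); (3,[::3;1;15]); (3,[::2;13;29]); (3,[::3;1])]))
(Leaf 53 [:: (52,[::0;3;9;27]); (43,[::3;9;27]); (41,[::0;1;9;27]); (39,[::1;4]); (29,[::2;5]);
(26,[::1;3;27]); (21,[::7;12]); (17,[::4;9;27]); (17,[::13;27]); (15,[::1;12;27]);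
(11,[::2;5;28]); (9,[::1;9;27]); (10,[::2;5;38]); (10,[::1;4;28]); (9,[::2;5;11]);
(5,[::0;10;28]); (4,[::1;4;10]); (4,[::9;1;27]); (4,[::1;11;27]); (4,[::10;38]); (3,[::0;3;28]);
(3,[::6;1;12]); (3,[::0;1;36]); (2,[::0;1]); (3,[::1;3;9]); (3,[::28;3;9]); (2,[::1;11;28]);
(4,[::22;36]); (7,[::1;5;9]); (1,[::2;5;9]); (1,[::3;9;33]); (1,[::6;33]); (1,[::27;3;9])])))
(Leaf 2 [:: (2,[::6;15;27]); (2,[::2;5]); (2,[::1;9;27]); (2,[::0;3;9;27]); (2,[::6;16;27]);
(1,[::0;1;3;27]); (1,[::36;1]); (1,[::9;1;27]); (1,[::6;1;12]); (1,[::0;3;27]); (1,[::1;4;27]);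
(1,[::2;5;27]); (1,[::21;1;39])])));
(525, Branch 19
(Branch 54
(Branch 0
(Branch 27
(Branch 12
(Leaf 34 [:: (17,[::0;1;3;9;27]); (17,[::0;3;9;27]); (15,[::21;36]); (14,[::1;11;27]);
(14,[::2;11;27]); (14,[::9;1;27]); (14,[::1;9;27]); (12,[::0;1;3]); (11,[::4;9;27]);
(12,[::21;45]); (11,[::28;4]); (11,[::6;15;27]); (3,[::3;27]); (8,[::2;5]); (6,[::33;15]);
(6,[::2;38]); (3,[::4;30]); (4,[::3;9;27]); (4,[::2;11]); (4,[::3;1;30]); (4,[::1;3;27]);
(3,[::2;5;28]); (3,[::0;1;9;27]); (4,[::1;5;27]); (3,[::4;9]); (2,[::18;42]); (2,[::21;1;36]);
(3,[::3;15;27]); (1,[::2;35]); (1,[::7;12;30]); (1,[::3;1]); (1,[::4;15;30]); (3,[::3;10;27]);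
(1,[::4;10;28]); (1,[::22;45])])
(Leaf 27 [:: (16,[::3;9;27]); (15,[::0;3;9;27]); (12,[::1;11;27]); (12,[::2;11;27]);
(12,[::0;1;3;9;27]); (12,[::9;1;27]); (10,[::2;5]); (9,[::1;9;27]); (8,[::1;3;27]);
(10,[::13;27]); (6,[::12;48]); (6,[::6;15;27]); (6,[::2;5;11]); (5,[::3;1;9]); (5,[::33;15]);
(5,[::21;1;36]); (4,[::2;5;28]); (4,[::28;4]); (3,[::2;34]); (3,[::5;10]); (3,[::1;3;36]);
(3,[::0;1;9;27]); (3,[::1;3]); (3,[::28;9]); (3,[::2;35]); (3,[::5;31]); (2,[::3;1;27]);
(2,[::5;10;28]); (3,[::3;27]); (1,[::0;1;3]); (3,[::1;27]); (1,[::3;9]); (1,[::12;42])]))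
(Leaf 96 [:: (75,[::0;3;9;27]); (50,[::0;1;9;27]); (41,[::2;5;28]); (30,[::4;9;27]);
(21,[::3;9;27]); (22,[::0;1;3]); (22,[::18;3;36]); (22,[::3;1;9]); (21,[::0;1;3;9;27]);
(20,[::27;9]); (13,[::1;9;27]); (19,[::2;38]); (17,[::1;3;27]); (17,[::0;1;3;27]);
(12,[::27;3]); (15,[::27;1;9]); (30,[::10;27]); (14,[::20;4;38]); (14,[::6;12;30]);
(11,[::3;1]); (11,[::2;11]); (11,[::0;1;9]); (2,[::6;15;27]); (10,[::9;1;27]); (14,[::27;3;10]);
(33,[::1;14;27]); (8,[::33;15]); (8,[::7;12;30]); (8,[::22;36]); (7,[::1;3;29]); (7,[::9;45]);
(15,[::12;27]); (20,[::10;3;27]); (4,[::9;1;45]); (4,[::7;12]); (3,[::3;1;9;27]);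
(1,[::1;9;29])]))
(Leaf 168 [:: (168,[::0;3;9;27]); (76,[::0;1;9;27]); (73,[::0;1;3;27]); (62,[::1;9;27]);
(64,[::4;30]); (67,[::12;1;27]); (44,[::0;1;36]); (38,[::21;36]); (42,[::4;9;27]);
(37,[::9;1;27]); (35,[::0;4;28]); (33,[::0;1;9]); (1,[::13;27]); (32,[::2;11]); (32,[::33;15]);
(29,[::21;1;36]); (29,[::3;1;9]); (29,[::7;12;30]); (30,[::28;9]); (27,[::0;1;3]);
(27,[::0;5;10]); (23,[::0;15;33]); (22,[::2;5;38]); (21,[::0;10]); (21,[::0;3;9]);
(21,[::0;11;29]); (19,[::2;5;28]); (12,[::1;3;27]); (12,[::3;1;9;27]); (11,[::0;10;28]);
(9,[::2;38]); (6,[::3;9;27]); (11,[::0;15;30]); (6,[::6;15;27]); (9,[::1;12;27]);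
(8,[::10;3;27])]))
(Branch 33
(Leaf 17 [:: (15,[::0;3;9;27]); (13,[::0;1;9;27]); (7,[::1;3;27]); (6,[::2;5;28]);
(5,[::3;1;9;27]); (5,[::2;29]); (5,[::0;1;3]); (4,[::3;9;27]); (4,[::9;36]); (3,[::2;9;29]);
(3,[::3;1;9]); (4,[::1;9;27]); (2,[::6;33]); (2,[::4;10;28]); (5,[::10;5;27]); (2,[::7;12]);
(2,[::18;1;45]); (2,[::4;9;27]); (2,[::1;4;28]); (2,[::21;1;36]); (4,[::10;3;27]);
(1,[::6;12;33]); (1,[::1;3;9]); (1,[::2;11;29]); (1,[::3;1;30]); (1,[::1;9;28]);
(1,[::0;1;3;9;27]); (1,[::6;15;33]); (1,[::6;9;33]); (1,[::7;12;34]); (1,[::18;3;45])])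
(Leaf 28 [:: (28,[::0;3;9;27]); (17,[::2;29]); (14,[::3;1;30]); (14,[::0;1;9;27]);
(14,[::20;47]); (13,[::0;1;3;27]); (12,[::1;3;9]); (12,[::1;9;27]); (12,[::9;1;27]);
(10,[::6;15;27]); (8,[::4;9;27]); (8,[::3;9;27]); (7,[::21;1;36]); (7,[::2;34]); (5,[::21;38]);
(4,[::13;27]); (4,[::21;45]); (4,[::2;5;11]); (3,[::12;1;27]); (2,[::12;48]); (2,[::33;15]);
(2,[::9;1;36]); (1,[::36;1]); (1,[::1;3;28]); (2,[::1;3;36]); (1,[::3;9;30]); (1,[::4;10;28]);
(1,[::2;5;28]); (1,[::3;1;9]); (1,[::0;1;36]); (1,[::1;16;35])])))
(Branch 0
(Branch 6
(Branch 27
(Branch 63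
(Leaf 33 [:: (19,[::0;3;9;27]); (8,[::19;45]); (14,[::3;9;27]); (14,[::0;1;3;9;27]);
(14,[::2;29]); (13,[::0;1;9;27]); (13,[::1;3;9]); (11,[::1;9]); (10,[::2;10]); (10,[::3;1;27]);
(8,[::6;15;27]); (13,[::4;12;30]); (9,[::21;36]); (6,[::3;1]); (6,[::0;1;9]); (9,[::19;47]);
(8,[::19;5;45]); (5,[::1;9;27]); (2,[::12;48]); (4,[::2;10;29]); (4,[::4;9;27]); (4,[::1;3;27]);
(7,[::8;16;28]); (8,[::28;4;11]); (3,[::2;11;27]); (3,[::33;15]); (2,[::3;1;9]); (2,[::27;1;9]);
(1,[::2;4;29]); (1,[::2;11;29]); (1,[::0;5;29]); (2,[::18;1;42]); (1,[::18;42])])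
(Leaf 20 [:: (14,[::19;45]); (13,[::1;3;9]); (12,[::0;1;9;27]); (12,[::3;1;27]); (11,[::21;39]);
(11,[::6;15;27]); (9,[::2;29]); (8,[::19;42]); (7,[::3;9;27]); (7,[::9;3;27]); (7,[::0;3;9;27]);
(7,[::1;9]); (6,[::3;15;27]); (5,[::0;1;3;9;27]); (4,[::4;12;30]); (3,[::2;10;27]);
(3,[::2;9;29]); (2,[::1;3;27]); (2,[::18;3;36]); (2,[::0;15;33]); (3,[::2;11]); (3,[::2;10;29]);
(1,[::2;17;30]); (1,[::4;30]); (1,[::20;4;38]); (1,[::3;1;9;27]); (1,[::3;9;30]); (1,[::3;1;9]);
(1,[::1;27])]))
(Branch 63
(Leaf 16 [:: (8,[::0;3;9;27]); (8,[::3;9;27]); (8,[::2;10;28]); (8,[::0;1;3;9;27]);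
(6,[::27;3]); (2,[::1;9]); (8,[::1;9;29]); (4,[::2;4;29]); (4,[::2;3;29]); (4,[::0;1;9;27]);
(3,[::1;9;27]); (3,[::3;1;9]); (3,[::4;10;28]); (3,[::6;15;27]); (3,[::0;1;9]); (3,[::18;1;45]);
(3,[::1;3;9]); (2,[::19;45]); (2,[::27;1]); (2,[::4;9;27]); (2,[::12;27]); (2,[::18;3;36]);
(3,[::4;12;30]); (3,[::4;12;33]); (1,[::1;3;27]); (1,[::27;1;9]); (1,[::9;1;45]); (1,[::18;42]);
(1,[::3;1;27])])
(Leaf 17 [:: (12,[::0;1;9;27]); (11,[::1;3;9]); (10,[::0;3;9;27]); (8,[::19;42]); (7,[::12;27]);
(8,[::2;10;28]); (7,[::3;1;27]); (6,[::3;9;27]); (6,[::18;3;36]); (5,[::21;39]); (5,[::18;36]);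
(4,[::1;9;27]); (4,[::4;9;27]); (3,[::2;5;28]); (3,[::19;45]); (3,[::1;9;29]); (3,[::9;3;27]);
(3,[::0;15;33]); (2,[::27;9]); (2,[::3;1]); (2,[::2;4;29]); (2,[::2;3;29]); (2,[::11;29]);
(2,[::2;9;29]); (2,[::3;1;33]); (1,[::27;12]); (2,[::20;4;38]); (2,[::27;1;9]);
(2,[::0;1;3;27]); (1,[::3;9;30]); (2,[::27;3;9]); (1,[::2;13;29]); (1,[::1;3;27]);
(3,[::10;5;28]); (1,[::2;3;10]); (1,[::0;1;3;9;27]); (1,[::12;1;27])])))
(Branch 27
(Leaf 360 [:: (163,[::19;45]); (184,[::2;5]); (193,[::0;3;9;27]); (178,[::6;15;27]);
(168,[::3;9;27]); (167,[::0;1;3;9;27]); (62,[::1;9]); (129,[::1;3;9]); (159,[::0;1;9;27]);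
(128,[::3;1;27]); (124,[::6;12;27]); (121,[::19;42]); (187,[::1;9;27]); (21,[::2;9;29]);
(9,[::2;10;29]); (6,[::0;1;3;27]); (22,[::13;27]); (26,[::19;37]); (23,[::18;1;45]);
(22,[::19;3;36]); (58,[::2;5;29]); (5,[::19;47]); (28,[::9;4;27]); (14,[::3;1;9]);
(44,[::2;4;29]); (27,[::2;5;10]); (13,[::6;1;12]); (8,[::1;4;27]); (7,[::2;5;28]);
(37,[::2;3;29]); (1,[::7;12;30]); (14,[::6;48]); (14,[::21;1;45]); (2,[::1;9;28])])
(Leaf 720 [:: (615,[::0;3;9;27]); (465,[::19;45]); (465,[::2;5]); (325,[::1;9]);
(244,[::12;27]); (314,[::0;1;9;27]); (244,[::6;30]); (209,[::0;1;3;9;27]); (209,[::0;1;3;27]);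
(209,[::3;1]); (197,[::27;1;9]); (174,[::4;9;27]); (163,[::18;3;36]); (209,[::12;1;27]);
(128,[::27;1;3]); (128,[::7;12;30]); (128,[::19;5;38]); (116,[::1;9;27]); (81,[::6;42]);
(81,[::18;1;36]); (81,[::6;1;12]); (81,[::2;10;28]); (81,[::27;3]); (81,[::6;12;30]);
(105,[::1;9;29]); (58,[::0;1;3;9]); (58,[::2;9;29]); (46,[::2;5;28]); (35,[::3;1;9]);
(35,[::0;3;27]); (35,[::1;3;9]); (70,[::1;5;9])])))
(Branch 33
(Leaf 37 [:: (34,[::0;3;9;27]); (24,[::2;5]); (24,[::19;45]); (21,[::0;1;9;27]);
(17,[::3;1;9;27]); (17,[::19;42]); (14,[::1;3;9]); (14,[::12;27]); (13,[::1;9;27]);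
(11,[::0;1;3;27]); (11,[::0;1;9]); (9,[::0;10;28]); (6,[::3;9;27]); (6,[::7;12;30]);
(6,[::0;5;11]); (5,[::0;9;27]); (5,[::0;11;29]); (4,[::0;1;36]); (3,[::28;3]); (3,[::0;15;30]);
(3,[::19;5;38]); (3,[::0;3;9]); (3,[::3;1;27]); (3,[::4;28]); (3,[::28;3;9]); (1,[::19;36]);
(2,[::2;5;38]); (2,[::19;5;46]); (5,[::0;11;28]); (1,[::36;1;3]); (1,[::2;29])])
(Leaf 50 [:: (48,[::0;3;9;27]); (31,[::19;45]); (26,[::4;9;27]); (26,[::0;1;9]);
(24,[::1;9;27]); (24,[::0;1;9;27]); (23,[::12;27]); (21,[::19;42]); (21,[::28;4]);
(21,[::0;15;33]); (20,[::0;1;3]); (19,[::36;1]); (14,[::21;36]); (15,[::0;1;3;27]);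
(13,[::1;3;9]); (8,[::3;1;9]); (7,[::27;1;3]); (6,[::0;33]); (6,[::2;34]); (5,[::6;15;27]);
(5,[::2;5]); (5,[::0;4;28]); (4,[::3;1;30]); (3,[::0;3;27]); (3,[::10;28]); (5,[::0;10]);
(2,[::0;1;3;9;27]); (2,[::1;9;28]); (2,[::2;5;29]); (7,[::0;15;30]); (12,[::12;48]);
(1,[::5;10;28]); (1,[::27;3]); (1,[::12;1;27])]))));
(560, Leaf 19 [:: (13,[::0;3;9;27]); (10,[::0;1;9;27]); (9,[::1;9;27]); (8,[::3;9;27]);
(7,[::0;1;3;27]); (6,[::0;1;3;9;27]); (5,[::6;15;27]); (5,[::1;3;9]); (5,[::4;12;30]);
(4,[::2;5]); (4,[::2;38]); (3,[::4;9;27]); (3,[::9;1;27]); (2,[::3;1;9;27]); (2,[::2;5;10]);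
(2,[::20;4;38]); (1,[::9;27]); (2,[::3;1;9]); (2,[::27;9]); (1,[::2;11]); (1,[::28;4]);
(1,[::21;36]); (1,[::2;11;29]); (1,[::0;15;33]); (1,[::5;31]); (2,[::9;3;27]); (1,[::33;15]);
(1,[::0;1;9]); (1,[::2;3;29]); (1,[::10;3;27]); (1,[::7;12;30]); (1,[::4;10;29])]);
(784, Branch 36
(Branch 19
(Branch 15
(Leaf 33 [:: (28,[::0;3;9;27]); (17,[::10;27]); (14,[::0;1;9;27]); (15,[::1;3;27]);
(16,[::0;1;3;9;27]); (9,[::3;9;27]); (9,[::3;1;9;27]); (8,[::2;5;10]); (3,[::4;9;27]);
(2,[::0;1;3;27]); (1,[::2;5]); (10,[::1;9;27]); (4,[::28;4]); (1,[::6;15;27]); (3,[::2;9;29]);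
(3,[::10;3;27]); (3,[::5;14;31]); (3,[::0;1;45]); (3,[::2;28]); (3,[::2;11;27]); (2,[::0;1;27]);
(2,[::1;3;9]); (2,[::30;1;9]); (2,[::5;10;29]); (1,[::12;48]); (1,[::2;11;28]); (9,[::2;5;27]);
(1,[::1;15;35]); (1,[::0;1;3]); (1,[::3;30])])
(Leaf 840 [:: (667,[::0;1;3;9;27]); (617,[::0;3;9;27]); (77,[::1;27]); (369,[::2;5]);
(173,[::1;3;27]); (142,[::0;15;33]); (509,[::1;9;27]); (113,[::3;12;30]); (112,[::0;1;27]);
(107,[::0;1;9;27]); (109,[::3;9;27]); (105,[::2;16]); (104,[::2;38]); (93,[::2;11;27]);
(87,[::9;3;45]); (64,[::4;14]); (77,[::9;1;3]); (68,[::9;3]); (60,[::3;1;45]); (58,[::3;1;27]);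
(171,[::4;15;27]); (55,[::3;1;9;27]); (53,[::18;3;36]); (44,[::15;1;33]); (30,[::15;42]);
(34,[::2;10;29]); (28,[::30;1;9]); (28,[::10;3;27]); (27,[::2;11;28]); (19,[::2;5;10]);
(17,[::4;10;28]); (20,[::0;1;45]); (15,[::0;1]); (13,[::4;9;27]); (6,[::4;28]); (5,[::9;5;29]);
(5,[::15;51]); (8,[::2;5;28]); (2,[::18;1;36])]))
(Branch 0
(Leaf 120 [:: (104,[::0;1;3;9;27]); (80,[::0;3;9;27]); (25,[::1;9]); (90,[::1;9;27]);
(10,[::19;45]); (41,[::2;5]); (64,[::4;12]); (21,[::3;9;27]); (17,[::3;12;30]);
(16,[::2;10;29]); (13,[::0;15;33]); (13,[::2;11;27]); (12,[::2;46]); (12,[::2;10;28]);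
(11,[::9;3;45]); (11,[::2;9;29]); (11,[::1;3;27]); (10,[::2;10]); (9,[::3;1;9;27]);
(8,[::2;28]); (5,[::18;1;36]); (7,[::18;3;36]); (5,[::6;9;33]); (4,[::0;1;9]); (4,[::6;15;30]);
(4,[::15;33]); (3,[::4;9;27]); (3,[::0;1;3;27]); (3,[::3;9;30]); (2,[::2;5;28]); (2,[::1;9;30]);
(2,[::4;10;28]); (2,[::2;3;10]); (2,[::12;1;27]); (4,[::18;36]); (1,[::5;13;29]);
(1,[::2;4;11]); (1,[::12;1]); (1,[::12;48]); (1,[::0;1;3;9])])
(Leaf 32 [:: (25,[::0;3;9;27]); (24,[::0;1;3;9;27]); (20,[::19;36]); (16,[::19;45]);
(13,[::0;1;9]); (6,[::4;12]); (8,[::0;4;10]); (7,[::0;1]); (9,[::1;9;27]); (6,[::2;10;28]);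
(6,[::4;9;27]); (6,[::0;1;3;27]); (5,[::0;3;45]); (4,[::3;9;27]); (3,[::12;48]);
(3,[::2;10;29]); (3,[::0;15;33]); (5,[::4;15;27]); (5,[::4;11;27]); (2,[::2;5]);
(2,[::0;1;9;27]); (2,[::1;3;9]); (2,[::5;13;32]); (2,[::6;9;33]); (2,[::0;12;33]);
(2,[::0;1;30]); (2,[::0;11;29]); (1,[::10;28]); (1,[::27;3]); (2,[::31;9])])))
(Branch 21
(Branch 27
(Leaf 240 [:: (177,[::1;9;27]); (170,[::0;1;3;9;27]); (155,[::0;3;9;27]); (117,[::2;5]);
(70,[::0;1;9;27]); (70,[::3;1;27]); (70,[::9;3;27]); (52,[::0;12;33]); (52,[::3;12;30]);
(42,[::27;3;9]); (27,[::2;5;29]); (27,[::1;3;9;27]); (25,[::2;46]); (23,[::12;1;27]);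
(23,[::2;4;11]); (14,[::2;12;35]); (9,[::4;12;30]); (9,[::1;3;9]); (11,[::4;30]);
(9,[::1;3;27]); (9,[::2;5;10]); (9,[::0;15;33]); (7,[::0;1;36]); (11,[::4;9;27]);
(7,[::0;1;30]); (7,[::7;9;33]); (9,[::3;9;27]); (4,[::2;11;27]); (5,[::0;9;27]); (9,[::4;12]);
(4,[::0;1]); (2,[::31;9]); (2,[::2;5;38])])
(Leaf 144 [:: (108,[::0;3;9;27]); (101,[::0;1;3;9;27]); (95,[::1;9;27]); (65,[::2;5]);
(43,[::0;1;9;27]); (36,[::9;3;27]); (30,[::27;3;9]); (27,[::3;1;27]); (24,[::2;28]);
(24,[::3;12;30]); (21,[::4;12;33]); (17,[::4;45]); (15,[::0;1;36]); (12,[::2;4;11]);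
(10,[::1;3;9]); (11,[::12;1]); (11,[::0;12;33]); (10,[::2;12;35]); (9,[::0;1;3;27]);
(3,[::4;9;27]); (6,[::15;30]); (5,[::3;9;27]); (6,[::27;9]); (6,[::12;36]); (6,[::27;3]);
(6,[::12;1;27]); (2,[::1;3;27]); (5,[::2;5;28]); (4,[::19;3;36]); (10,[::1;3;9;27]);
(4,[::2;3;29]); (14,[::4;15;27]); (2,[::4;12]); (2,[::1;9;30]); (2,[::3;1;9;27]);
(1,[::5;10;29]); (1,[::0;1;12]); (1,[::10;4;47])]))
(Branch 30
(Leaf 47 [:: (39,[::0;3;9;27]); (29,[::0;1;3;9;27]); (27,[::1;9;27]); (18,[::0;1;9;27]);
(19,[::2;5]); (12,[::33;12]); (12,[::1;3;27]); (11,[::15;30]); (8,[::10;27]); (8,[::4;10;28]);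
(6,[::3;9]); (6,[::3;12;30]); (6,[::0;15;33]); (5,[::3;1;9]); (3,[::2;38]); (4,[::4;12;33]);
(4,[::1;3;9]); (4,[::5;11;27]); (2,[::2;5;10]); (3,[::2;5;28]); (2,[::2;28]); (3,[::21;45]);
(3,[::3;1;9;27]); (3,[::2;3;10]); (4,[::10;5;27]); (7,[::2;17;32]); (2,[::4;9;27]);
(2,[::1;9;30]); (2,[::21;39]); (2,[::0;1;3]); (2,[::2;3;29]); (2,[::2;11;27]); (3,[::3;9;28]);
(3,[::2;10;28]); (1,[::19;3;36]); (1,[::3;9;27]); (1,[::19;36]); (1,[::4;11;27])])
(Leaf 53 [:: (43,[::0;3;9;27]); (39,[::1;9;27]); (38,[::0;1;3;9;27]); (20,[::2;5]);
(17,[::3;9;27]); (13,[::30;1]); (15,[::4;9;27]); (13,[::0;1;9;27]); (12,[::1;3;27]);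
(11,[::10;27]); (10,[::4;10]); (9,[::0;15;30]); (8,[::21;39]); (5,[::27;3;9]); (6,[::2;3;10]);
(5,[::2;5;10]); (5,[::18;45]); (3,[::5;13]); (5,[::27;3]); (6,[::2;31]); (3,[::0;15;33]);
(3,[::3;12;30]); (3,[::2;3;29]); (3,[::3;1;27]); (10,[::2;17;32]); (2,[::2;11;27]); (2,[::3;9]);
(3,[::1;3]); (1,[::2;3;28]); (1,[::18;1;45]); (1,[::9;1;27]); (1,[::2;46]); (1,[::2;11;29]);
(1,[::2;9;28]); (1,[::15;51])]))));
(840, Leaf 2 [:: (2,[::0;1;3;9;27]); (1,[::0;3;9;27]); (1,[::1;9;27]); (1,[::2;5;27]);
(1,[::3;9;27]); (1,[::0;1;9;27]); (1,[::4;27])]);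
(1176, Leaf 2 [:: (2,[::0;1;3;9;27]); (1,[::0;3;9;27]); (1,[::1;9;27]); (1,[::4;27]);
(1,[::2;5;27]); (1,[::3;9;27]); (1,[::0;1;9;27]); (1,[::11;5])]);
(1680, Branch 57
(Branch 0
(Leaf 840 [:: (840,[::0;1;3;9;27]); (430,[::0;3;9;27]); (401,[::2;5;27]); (368,[::11;5]);
(221,[::7;15]); (287,[::3;9;27]); (281,[::1;9;27]); (256,[::1;3;27]); (224,[::0;1;9;27]);
(140,[::2;11;27]); (112,[::4;27]); (122,[::7;13;34]); (63,[::9;33]); (66,[::7;35]);
(63,[::9;1;27]); (42,[::9;3;27]); (16,[::3;36]); (40,[::27;1;9]); (62,[::4;15;27]);
(114,[::7;15;32]); (32,[::12;30]); (33,[::2;4]); (33,[::1;10;28]); (58,[::3;16;32]);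
(30,[::2;9;29]); (5,[::12;45]); (37,[::1;14;32]); (12,[::2;11;28]); (9,[::1;3;29]);
(9,[::3;15;33]); (7,[::0;3;36]); (5,[::30;12]); (9,[::7;14;33]); (7,[::7;17;30]);
(2,[::6;1;30]); (3,[::13;42])])
(Leaf 35 [:: (35,[::0;1;3;9;27]); (16,[::0;3;9;27]); (15,[::0;1;9;27]); (11,[::0;5;11]);
(11,[::2;5;27]); (10,[::1;9;27]); (10,[::0;42]); (2,[::4;27]); (8,[::0;1;3]); (8,[::3;9;27]);
(6,[::0;5;28]); (6,[::0;5;29]); (5,[::11;5]); (7,[::4;11;27]); (7,[::4;15;27]); (3,[::11;5;38]);
(3,[::12;30]); (2,[::30;9]); (2,[::0;9;28]); (2,[::27;3;9]); (1,[::7;33]); (2,[::0;10;29]);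
(2,[::7;30]); (1,[::2;11;27]); (1,[::27;15]); (1,[::3;15;33]); (1,[::0;12;30]); (1,[::11;38]);
(2,[::1;5;45]); (1,[::7;14;33])]))
(Branch 36
(Leaf 17 [:: (17,[::0;1;3;9;27]); (9,[::11;5]); (8,[::0;3;9;27]); (7,[::3;9;27]);
(7,[::1;9;27]); (6,[::7;15]); (6,[::2;5;27]); (5,[::4;27]); (4,[::7;31]); (4,[::0;1;9;27]);
(2,[::1;3;27]); (2,[::2;9;29]); (2,[::9;1;36]); (2,[::2;11;27]); (2,[::0;9;33]);
(2,[::6;15;30]); (2,[::21;45]); (2,[::4;15;27]); (1,[::1;11;29]); (1,[::0;1;3;27]);
(1,[::0;1;45]); (1,[::1;3]); (1,[::2;4;28]); (1,[::0;5;28]); (2,[::13;32])])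
(Leaf 420 [:: (420,[::0;1;3;9;27]); (212,[::0;3;9;27]); (190,[::2;5;27]); (153,[::0;1;9;27]);
(110,[::1;9;27]); (144,[::3;9;27]); (135,[::11;5]); (9,[::4;27]); (132,[::1;3;27]);
(98,[::7;15]); (55,[::18;51]); (55,[::7;13;34]); (55,[::6;9;30]); (55,[::9;1;27]);
(52,[::36;3]); (21,[::12;36]); (21,[::2;4;27]); (77,[::4;15;27]); (25,[::2;4;38]);
(37,[::7;15;35]); (18,[::0;12;33]); (12,[::1;45]); (25,[::10;5;36]); (12,[::0;11;28]);
(12,[::2;32]); (12,[::1;3;38]); (9,[::0;5;11]); (55,[::29;10]); (18,[::2;4]); (3,[::15;30]);
(6,[::0;5;28]); (6,[::7;11;30]); (9,[::0;13;32])])));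
(1960, Branch 2
(Branch 12
(Branch 30
(Branch 27
(Branch 75
(Leaf 48 [:: (48,[::0;1;3;9;27]); (30,[::0;3;9;27]); (28,[::1;9;27]); (16,[::2;5;27]);
(14,[::24;52]); (12,[::3;45]); (10,[::7;31]); (9,[::1;3;27]); (3,[::13;27]); (7,[::0;1;9;27]);
(7,[::11;5;29]); (7,[::7;15]); (22,[::4;9;27]); (6,[::7;13;34]); (5,[::36;3]); (5,[::2;11;27]);
(5,[::11;5]); (4,[::9;1]); (4,[::0;5;11]); (4,[::7;13]); (4,[::3;15;33]); (3,[::7;13;31]);
(3,[::1;10;28]); (2,[::7;16;31]); (2,[::9;1;36]); (2,[::0;11;28]); (2,[::0;3;45]);
(1,[::0;15;33]); (1,[::7;30]); (1,[::0;5;29]); (1,[::10;36]); (1,[::0;9;28]); (1,[::15;33]);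
(1,[::1;3;38])])
(Leaf 56 [:: (55,[::0;1;3;9;27]); (31,[::0;3;9;27]); (28,[::7;15]); (26,[::11;5]);
(26,[::1;9;27]); (18,[::3;36]); (23,[::24;52]); (20,[::0;42]); (25,[::4;27]); (15,[::57;9]);
(18,[::1;3;27]); (16,[::6;12;27]); (15,[::2;11;27]); (11,[::1;10;28]); (10,[::2;5;27]);
(8,[::9;1;36]); (8,[::2;9;29]); (1,[::4;10;27]); (3,[::10;46]); (13,[::29;14]); (2,[::7;31]);
(8,[::3;9;27]); (2,[::7;30]); (2,[::0;11;29]); (2,[::4;16]); (2,[::7;33]); (2,[::9;33]);
(1,[::8;9;32]); (1,[::5;17;30]); (1,[::1;45]); (3,[::10;27]); (1,[::5;11;27]); (1,[::1;3;9;27]);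
(1,[::0;13;32]); (1,[::28;9]); (3,[::0;5;38])]))
(Leaf 31 [:: (31,[::0;1;3;9;27]); (15,[::0;3;9;27]); (13,[::1;9;27]); (12,[::0;1;9;27]);
(9,[::2;5;27]); (3,[::27;15]); (7,[::11;5]); (6,[::24;39]); (5,[::6;1;30]); (5,[::1;3;29]);
(5,[::3;36]); (4,[::3;12;33]); (4,[::24;52]); (4,[::3;9;27]); (3,[::3;15;33]); (3,[::7;13;34]);
(3,[::7;33]); (3,[::6;9;30]); (2,[::0;5;29]); (2,[::7;13;31]); (17,[::4;9;27]); (5,[::10;27]);
(1,[::0;5;11]); (1,[::1;11;29]); (1,[::27;1;9]); (1,[::36;3]); (5,[::7;15;32]); (1,[::0;15;27]);
(1,[::9;1;36]); (5,[::7;13;32])]))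
(Leaf 6 [:: (6,[::0;1;3;9;27]); (6,[::7;35]); (5,[::1;9;27]); (5,[::0;3;9;27]); (5,[::4;9;27]);
(1,[::1;10;28]); (1,[::3;9;27]); (1,[::9;1;45]); (1,[::0;11;29]); (1,[::4;16;34]); (1,[::6;32]);
(1,[::11;5;45]); (1,[::11;32])]))
(Branch 56
(Leaf 16 [:: (16,[::0;1;3;9;27]); (12,[::0;3;9;27]); (9,[::1;9;27]); (5,[::7;15]); (4,[::11;5]);
(4,[::1;10;28]); (3,[::3;9;27]); (3,[::9;1;45]); (3,[::1;3;27]); (2,[::6;32]); (2,[::2;5;27]);
(2,[::4;16]); (3,[::4;15;27]); (2,[::0;5;29]); (1,[::0;11;29]); (1,[::28;9]); (1,[::7;13]);
(1,[::10;36]); (2,[::12;30]); (1,[::3;15;33]); (1,[::0;12;30]); (1,[::29;11]); (6,[::4;9;27]);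
(1,[::29;5;11]); (4,[::7;42]); (1,[::7;15;27])])
(Leaf 11 [:: (11,[::0;1;3;9;27]); (5,[::24;52]); (6,[::0;3;9;27]); (5,[::2;5;27]);
(5,[::3;9;27]); (5,[::11;5]); (4,[::7;15]); (5,[::12;30]); (3,[::1;9;27]); (3,[::1;29]);
(3,[::9;1;36]); (3,[::0;11;28]); (3,[::18;46]); (2,[::9;37]); (2,[::2;11;27]); (2,[::0;1;27]);
(2,[::29;10]); (2,[::1;3;27]); (2,[::4;15;27]); (4,[::7;42]); (1,[::1;3;9;27]);
(1,[::4;9;27])])))
(Branch 27
(Branch 9
(Leaf 72 [:: (72,[::0;1;3;9;27]); (33,[::2;5;27]); (32,[::3;9;27]); (29,[::0;3;9;27]);
(29,[::1;9;27]); (23,[::2;14]); (18,[::7;15]); (17,[::1;3;27]); (17,[::2;11;27]);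
(16,[::0;1;9;27]); (12,[::4;27]); (11,[::11;5;38]); (10,[::2;9;29]); (10,[::2;4]);
(10,[::7;33]); (10,[::2;5;9]); (10,[::2;34]); (10,[::11;28]); (7,[::0;1]); (6,[::9;3;27]);
(6,[::0;42]); (6,[::0;5;11]); (6,[::2;47]); (5,[::7;12;35]); (5,[::15;30]); (5,[::18;3;45]);
(5,[::0;12;30]); (5,[::7;31]); (4,[::0;1;9]); (5,[::11;5;27]); (1,[::2;11]); (1,[::2;4;27]);
(67,[::2;41])])
(Leaf 52 [:: (52,[::0;1;3;9;27]); (28,[::0;3;9;27]); (23,[::2;5;27]); (21,[::1;3;27]);
(15,[::3;9;27]); (15,[::1;9;27]); (11,[::2;14]); (12,[::11;5]); (12,[::9;1;27]);
(12,[::0;1;9;27]); (11,[::2;10]); (12,[::2;4;10]); (10,[::2;11;27]); (9,[::9;3]); (7,[::30;9]);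
(8,[::0;42]); (7,[::9;33]); (7,[::7;13;34]); (26,[::2;41]); (5,[::9;37]); (7,[::4;9;27]);
(3,[::1;45]); (7,[::13;27]); (8,[::7;14;31]); (3,[::9;1;36]); (2,[::2;9;29]); (2,[::0;5;11]);
(1,[::7;30]); (1,[::0;9;33]); (1,[::0;9;30]); (4,[::34;15]); (1,[::2;5;9]); (1,[::0;1;9]);
(1,[::2;38]); (1,[::7;14;33]); (1,[::28;5;9])]))
(Leaf 30 [:: (30,[::0;1;3;9;27]); (16,[::2;14]); (14,[::0;3;9;27]); (12,[::4;27]);
(13,[::1;9;27]); (11,[::2;5;27]); (11,[::3;9;27]); (10,[::0;1;9;27]); (9,[::11;5]);
(5,[::1;3;29]); (5,[::6;1;30]); (5,[::2;4;28]); (4,[::7;13;34]); (4,[::2;11;27]);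
(4,[::9;3;27]); (2,[::2;9;29]); (2,[::0;1;9]); (2,[::2;9;28]); (2,[::15;48]); (3,[::7;42]);
(4,[::7;15;32]); (1,[::0;5;11]); (1,[::4;15;27]); (23,[::2;41]); (3,[::0;5;38]);
(1,[::4;11;27]); (1,[::27;5;11])])))].

Fixpoint check_jumps (g : Z) (l : seq (Z * cert)) :=
  if l is (j, c) :: l' then
    check (weight (j - 1)) g c [::] && check_jumps (g + 1) l'
  else true.
Lemma certs_ok : check_jumps 1 certs.
Proof. by vm_compute. Qed.

Local Close Scope Z_scope.

(** * Smooth and rough parts *)

Definition triple_free (s : seq nat) := forall a b c y,
  a \in s -> b \in s -> c \in s -> a < b -> b < c -> a * b * c <> y ^ 3.

Definition admissible (D : pred nat) x s :=
  [/\ uniq s, forall a, a \in s -> [&& 0 < a, a <= x & D a] & triple_free s].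

(** This is the function G of the overview when D is [smooth P], and [F 3 3] when D is [predT]. *)
Definition maxfree (D : pred nat) x : nat :=
  \max_(i < x.+1 | `[< exists2 s, admissible D x s & size s = i >]) i.

Lemma size_admissible D x s : admissible D x s -> size s <= x.
Proof.
move=> [us sD _]; rewrite -[leqRHS](size_iota 1); apply: uniq_leq_size => //.
by move=> a /sD /and3P[a0 ax _]; rewrite mem_iota a0.
Qed.

Lemma maxfree_ge D x s : admissible D x s -> size s <= maxfree D x.
Proof.
move=> ads; have lt : size s < x.+1 by rewrite ltnS (size_admissible ads).
apply: (@leq_bigmax_cond _ _ (fun i : 'I_x.+1 => i : nat) (Ordinal lt)).
by apply/asboolP; exists s.
Qed.

Lemma maxfree_ex D x : exists2 s, admissible D x s & size s = maxfree D x.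
Proof.
rewrite /maxfree; apply: (big_ind (fun m =>
  exists2 s, admissible D x s & size s = m)).
- by exists [::] => //; split.
- by move=> m n ? ?; rewrite /maxn; case: ifP.
- by move=> i /asboolP.
Qed.

Lemma maxfree_le D x : maxfree D x <= x.
Proof. by have [s /size_admissible + <-] := maxfree_ex D x. Qed.

Lemma maxfree_homo D x y : x <= y -> maxfree D x <= maxfree D y.
Proof.
move=> xy; have [s [us sD fs] <-] := maxfree_ex D x; apply: maxfree_ge.
split=> // a /sD/and3P[-> ax ->].
by rewrite (leq_trans ax xy).
Qed.

Lemma card_set_seq n (s : seq nat) : uniq s -> {in s, forall a, a <= n} ->
  #|[set i : 'I_n.+1 | (i : nat) \in s]| = size s.
Proof.
move=> us sn; rewrite cardE -(size_map val); apply/perm_size/uniq_perm => //.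
  by rewrite map_inj_uniq ?enum_uniq //; apply: val_inj.
move=> a; apply/mapP/idP => [[i + ->]|aS]; first by rewrite mem_enum inE.
by exists (Ordinal (sn a aS : a < n.+1)); rewrite // mem_enum inE.
Qed.

Lemma power_product_freeP n (A : {set 'I_n.+1}) :
  power_product_free 3 3 A <->
  admissible predT n [seq val i | i <- enum A].
Proof.
have memA (i : 'I_n.+1) : (val i \in [seq val i | i <- enum A]) = (i \in A).
  by rewrite (mem_map val_inj) mem_enum.
split=> [[A0 HA]|[us sD fs]].
  split.
  - by rewrite map_inj_uniq ?enum_uniq //; apply: val_inj.
  - move=> _ /mapP[i + ->]; rewrite mem_enum => iA.
    have -> : val i <= n by rewrite -ltnS; apply: ltn_ord.
    rewrite !andbT lt0n; apply: contra A0 => /eqP i0.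
    by rewrite (_ : ord0 = i) //; apply: val_inj.
  - move=> _ _ _ y /mapP[i + ->] /mapP[j + ->] /mapP[k + ->].
    rewrite !mem_enum => iA jA kA ij jk e; apply: HA.
    exists (fun t : 'I_3 => nth ord0 [:: i; j; k] t), (Posz y).
    split; first by case=> [[|[|[|]]] // ?] [[|[|[|]]] // ?] //= _;
      exact: ltn_trans ij jk.
      by case=> [[|[|[|]]]].
    by rewrite !big_ord_recl big_ord0 /= muln1 mulnA e !expnS expn0 muln1 !PoszM.
split.
  by apply/negP; rewrite -memA => /sD.
move=> [a [x [inc aA e]]].
pose i0 := @Ordinal 3 0 isT; pose i1 := @Ordinal 3 1 isT.
pose i2 := @Ordinal 3 2 isT.
(* An integer cube root of a product of naturals is replaced by its absolute value. *)
apply: (fs (a i0) (a i1) (a i2) `|x|%N); rewrite ?memA ?inc //.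
have -> : a i0 * a i1 * a i2 = \prod_(i < 3) a i.
  by rewrite !big_ord_recl big_ord0 muln1 mulnA; congr (_ * _ * _);
    congr (nat_of_ord (a _)); apply: val_inj.
by rewrite -[LHS]absz_nat e abszX.
Qed.

Lemma F_maxfree n : F 3 3 n = maxfree predT n.
Proof.
apply/eqP; rewrite eqn_leq; apply/andP; split.
  apply/bigmax_leqP => A /asboolP/power_product_freeP/maxfree_ge.
  by rewrite size_map -cardE.
have [s ads <-] := maxfree_ex predT n; have [us sD fs] := ads.
have sn : {in s, forall a, a <= n} by move=> a /sD/and3P[].
rewrite -(card_set_seq us sn); set A := [set i | _].
apply: (@leq_bigmax_cond _ _ (fun A : {set 'I_n.+1} => #|A|) A).
apply/asboolP/power_product_freeP.
have mem a : a \in [seq val i | i <- enum A] -> a \in s.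
  by move=> /mapP[i + ->]; rewrite mem_enum inE.
split.
- by rewrite map_inj_uniq ?enum_uniq //; apply: val_inj.
- by move=> a /mem/sD.
- by move=> a b c y /mem aS /mem bS /mem cS; apply: fs.
Qed.

Definition smooth P : pred nat := \pi(P).-nat.

(** A Kronecker delta, used to regroup sums according to the value of a function. *)
Lemma sum_pick (T : eqType) (r : seq T) (Q : pred T) (c : T -> nat) x :
  uniq r -> x \in r -> Q x -> \sum_(v <- r | Q v) (x == v) * c v = c x.
Proof.
move=> ur xr Qx; rewrite big_mkcond /= (bigD1_seq x) //= Qx eqxx mul1n big1 ?addn0 //.
by move=> v /negPf vx; rewrite eq_sym vx mul0n if_same.
Qed.

Section Smooth.
Variable P : nat.
Hypothesis P0 : 0 < P.
Local Notation pi := \pi(P).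

Lemma coprime_rough v : 0 < v -> coprime v P = (pi^').-nat v.
Proof. by move=> v0; rewrite coprime_sym coprime_pi' // P0. Qed.

Definition sqfree w := all (fun p => logn p w <= 1) (primes w).

Lemma sqfreeP w p : sqfree w -> logn p w <= 1.
Proof.
case: (boolP (p \in primes w)) => [pw /allP/(_ p pw) //|].
by rewrite -logn_gt0 -eqn0Ngt => /eqP->.
Qed.

Lemma sqfree_decomp v : 0 < v ->
  exists m w, [/\ 0 < m, 0 < w, sqfree w & v = m ^ 2 * w].
Proof.
elim/ltn_ind: v => v IH v0; case: (boolP (sqfree v)) => [sv|].
  by exists 1, v; rewrite mul1n.
case/allPn => p; rewrite mem_primes => /and3P[pr _ _]; rewrite -ltnNge.
rewrite -(pfactor_dvdn 2 pr v0) => /dvdnP[v' e].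
have v'0 : 0 < v' by move: v0; rewrite e; case: v' {e}.
have [|m [w [m0 w0 sw e']]] := IH v' _ v'0.
  by rewrite e -[ltnLHS]muln1 ltn_pmul2l // -{1}(exp1n 2) ltn_exp2r // prime_gt1.
exists (p * m), w; split=> //; first by rewrite muln_gt0 prime_gt0.
by rewrite e e' expnMn mulnC mulnA.
Qed.

(** Taking the rho-part is multiplicative, so a solution splits into a smooth and a rough one. *)
Lemma cube_parts a1 a2 a3 y : 0 < a1 -> 0 < a2 -> 0 < a3 ->
  a1 * a2 * a3 = y ^ 3 ->
  forall rho : nat_pred, a1`_rho * a2`_rho * a3`_rho = y`_rho ^ 3.
Proof. by move=> ? ? ? e rho; rewrite -partnX -e !partnM ?muln_gt0 //; lia. Qed.

Lemma cube_scale v a1 a2 a3 z : a1 * a2 * a3 = z ^ 3 ->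
  (a1 * v) * (a2 * v) * (a3 * v) = (z * v) ^ 3.
Proof. by move=> e; rewrite expnMn -e; lia. Qed.

(** At each prime the three exponents are 0 or 1 and their sum is a multiple of 3, so they are all 0
    or all 1. *)
Lemma sqfree_cube w1 w2 w3 y : sqfree w1 -> sqfree w2 -> sqfree w3 ->
  0 < w1 -> 0 < w2 -> 0 < w3 -> w1 * w2 * w3 = y ^ 3 -> w1 = w2 /\ w2 = w3.
Proof.
move=> s1 s2 s3 p1 p2 p3 e.
suff H p : logn p w1 = logn p w2 /\ logn p w2 = logn p w3.
  by split; apply: eqn_from_log => // p; have [] := H p.
have := congr1 (logn p) e; rewrite lognX !lognM ?muln_gt0 ?p1 //.
by have := sqfreeP p s1; have := sqfreeP p s2; have := sqfreeP p s3; lia.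
Qed.

Lemma maxfree_upper n :
  maxfree predT n <= \sum_(1 <= v < n.+1 | coprime v P) maxfree (smooth P) (n %/ v).
Proof.
have [s [us sD fs] <-] := maxfree_ex predT n.
have s0 a : a \in s -> 0 < a by move/sD/and3P=> [].
have -> : size s = \sum_(1 <= v < n.+1 | coprime v P)
                     count (fun a => a`_pi^' == v) s.
  under eq_bigr do rewrite -sum1_count big_mkcond.
  rewrite exchange_big /= -sum1_size; apply: eq_big_seq => a aS.
  have /and3P[a0 an _] := sD a aS.
  have aI : a`_pi^' \in index_iota 1 n.+1.
    rewrite mem_index_iota part_gt0 ltnS (leq_trans _ an) //.
    by apply: dvdn_leq => //; apply: dvdn_part.
  have cA : coprime a`_pi^' P by rewrite coprime_rough ?part_gt0 // part_pnat.
  apply: (etrans (esym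
    (sum_pick (Q := coprime^~ P) (fun=> 1) (iota_uniq _ _) aI cA))).
  by apply: eq_bigr => v _; case: eqP.
rewrite big_nat_cond [leqRHS]big_nat_cond; apply: leq_sum => v.
move=> /andP[/andP[v0 vn] cv].
rewrite -size_filter -(size_map (fun a => a`_pi)).
have E a : a \in [seq a <- s | a`_pi^' == v] -> a \in s /\ a`_pi * v = a.
  by rewrite mem_filter => /andP[/eqP<- aS]; rewrite partnC // s0.
apply: maxfree_ge; split.
- rewrite map_inj_in_uniq ?filter_uniq // => a b /E[_ ea] /E[_ eb] e.
  by rewrite -ea -eb e.
- move=> _ /mapP[a /E[aS ea] ->]; rewrite part_gt0 /smooth part_pnat leq_divRL //.
  by rewrite ea andbT; have /and3P[] := sD a aS.
(* Multiplication by v turns a solution among the smooth parts into a solution in s. *)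
- move=> _ _ _ y /mapP[a /E[aS ea] ->] /mapP[b /E[bS eb] ->] /mapP[c /E[cS ec] ->].
  move=> ab bc /(cube_scale v); rewrite ea eb ec; apply: fs => //.
    by rewrite -ea -eb ltn_pmul2r.
  by rewrite -eb -ec ltn_pmul2r.
Qed.

(* If w1, w2, w3 are squarefree and w1 * w2 * w3 is a cube, then w1 = w2 = w3;
   so optimal sets of smooth numbers chosen for the different w do not
   interact. *)
Lemma maxfree_lower_sqfree n :
  \sum_(1 <= w < n.+1 | coprime w P && sqfree w) maxfree (smooth P) (n %/ w) <=
  maxfree predT n.
Proof.
pose B x := sval (cid2 (maxfree_ex (smooth P) x)).
have BP x : admissible (smooth P) x (B x) by rewrite /B; case: cid2.
have Bs x : size (B x) = maxfree (smooth P) x by rewrite /B; case: cid2.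
pose W := [seq w <- index_iota 1 n.+1 | coprime w P && sqfree w].
pose s := [seq u * w | w <- W, u <- B (n %/ w)].
have -> : \sum_(1 <= w < n.+1 | coprime w P && sqfree w)
            maxfree (smooth P) (n %/ w) = size s.
  rewrite size_allpairs_dep sumnE big_map big_filter.
  by apply: eq_bigr => w _; rewrite Bs.
have WP w : w \in W -> [/\ 0 < w, w <= n, (pi^').-nat w & sqfree w].
  rewrite mem_filter mem_index_iota ltnS => /andP[/andP[cw sw] /andP[w0 wn]].
  by rewrite -coprime_rough.
have uP w u : u \in B (n %/ w) -> 0 < u /\ pi.-nat u.
  by have [_ H _] := BP (n %/ w) => /H/and3P[].
have parts w u : w \in W -> u \in B (n %/ w) ->
    [/\ 0 < u * w, (u * w)`_pi = u & (u * w)`_pi^' = w].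
  move=> /WP[w0 _ rw _] /uP[u0 su]; rewrite muln_gt0 u0 w0 !partnM //.
  rewrite (part_pnat_id su) (part_pnat_id rw) (part_p'nat rw) part_p'nat ?muln1 ?mul1n //.
  by rewrite pnatNK.
apply: maxfree_ge; split.
- apply: allpairs_uniq_dep => //.
  + by rewrite filter_uniq // iota_uniq.
  + by move=> w _; case: (BP (n %/ w)).
  + move=> _ _ /allpairsPdep[w [u [wW uB ->]]] /allpairsPdep[w' [u' [wW' uB' ->]]] /=.
    have [_ p1 p2] := parts w u wW uB; have [_ q1 q2] := parts w' u' wW' uB'.
    move=> e; have -> : u = u' by rewrite -p1 e q1.
    by have -> : w = w' by rewrite -p2 e q2.
- move=> _ /allpairsPdep[w [u [wW uB ->]]]; have [-> _ _] := parts w u wW uB.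
  have [_ /(_ u uB)/and3P[_ + _] _] := BP (n %/ w).
  by have [w0 _ _ _] := WP w wW; rewrite leq_divRL // => ->.
- move=> _ _ _ y /allpairsPdep[w1 [u1 [wW1 uB1 ->]]]
    /allpairsPdep[w2 [u2 [wW2 uB2 ->]]] /allpairsPdep[w3 [u3 [wW3 uB3 ->]]].
  move=> lt12 lt23 e.
  have [g1 p1 q1] := parts _ _ wW1 uB1; have [g2 p2 q2] := parts _ _ wW2 uB2.
  have [g3 p3 q3] := parts _ _ wW3 uB3.
  have := cube_parts g1 g2 g3 e pi^'; rewrite q1 q2 q3 => ew.
  have [h1 _ _ s1] := WP _ wW1; have [h2 _ _ s2] := WP _ wW2.
  have [h3 _ _ s3] := WP _ wW3.
  have [e12 e23] := sqfree_cube s1 s2 s3 h1 h2 h3 ew.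
  (* With equal rough parts, the three smooth parts belong to one and the same optimal set. *)
  rewrite -e23 -e12 in lt12 lt23 uB2 uB3.
  have := cube_parts g1 g2 g3 e pi; rewrite p1 p2 p3.
  have [_ _ fB] := BP (n %/ w1).
  by rewrite !ltn_pmul2r // in lt12 lt23; apply: fB.
Qed.

(** For fixed m, the terms v = m ^ 2 * w with w squarefree are bounded by [maxfree_lower_sqfree] at
    n / m ^ 2. *)
Lemma maxfree_lower n :
  \sum_(1 <= v < n.+1 | coprime v P) maxfree (smooth P) (n %/ v) <=
  \sum_(1 <= m < n.+1 | coprime m P) maxfree predT (n %/ m ^ 2).
Proof.
apply: (@leq_trans (\sum_(1 <= m < n.+1 | coprime m P)
  \sum_(1 <= w < (n %/ m ^ 2).+1 | coprime w P && sqfree w)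
    maxfree (smooth P) (n %/ m ^ 2 %/ w))); last first.
  by apply: leq_sum => m _; apply: maxfree_lower_sqfree.
(* The delta of v = m ^ 2 * w allows an exchange of the sums; each v then has to be hit by one pair
   (m, w), which [sqfree_decomp] provides. *)
apply: (@leq_trans (\sum_(1 <= m < n.+1 | coprime m P)
  \sum_(1 <= w < (n %/ m ^ 2).+1 | coprime w P && sqfree w)
   \sum_(1 <= v < n.+1 | coprime v P) (m ^ 2 * w == v) * maxfree (smooth P) (n %/ v))).
  under [leqRHS]eq_bigr do rewrite exchange_big.
  rewrite [leqRHS]exchange_big big_nat_cond [leqRHS]big_nat_cond /=.
  apply: leq_sum => v /andP[/andP[v0 vn] cv].
  have [m [w [m0 w0 sw e]]] := sqfree_decomp v0.
  have [cm cw] : coprime m P /\ coprime w P.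
    by move: cv; rewrite e coprimeMl coprime_pexpl // => /andP.
  have mn : m <= n.
    rewrite -ltnS (leq_trans _ vn) // ltnS e.
    by rewrite (leq_trans (leq_pexp2l m0 (isT : 1 <= 2))) // leq_pmulr.
  have mI : m \in index_iota 1 n.+1 by rewrite mem_index_iota m0 ltnS.
  have wI : w \in index_iota 1 (n %/ m ^ 2).+1.
    by rewrite mem_index_iota w0 ltnS leq_divRL ?expn_gt0 ?m0 // mulnC -e.
  rewrite big_mkcond (bigD1_seq _ mI (iota_uniq _ _)) /= cm.
  rewrite [X in _ <= X + _]big_mkcond (bigD1_seq _ wI (iota_uniq _ _)) /= cw sw.
  by rewrite -e eqxx mul1n -addnA leq_addr.
apply: leq_sum => m _; rewrite big_nat_cond [leqRHS]big_nat_cond.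
apply: leq_sum => w _; rewrite -divnMA.
case: (boolP ((m ^ 2 * w \in index_iota 1 n.+1) && coprime (m ^ 2 * w) P)).
  by case/andP => I c; rewrite sum_pick ?iota_uniq.
move=> nI; rewrite big_seq_cond big1 // => v /andP[vI cv].
by case: eqP => // e; move: nI; rewrite e vI cv.
Qed.
End Smooth.

(** * Classes of smooth numbers modulo cubes *)

Definition trit_of n := nth T0 trits (n %% 3).

Lemma trit_natK x : trit_of (trit_nat x) = x. Proof. by case: x. Qed.

Lemma trit_ofK n : trit_nat (trit_of n) = n %% 3.
Proof. by rewrite /trit_of; case: (n %% 3) (ltn_pmod n (isT : 0 < 3)) => [|[|[|]]]. Qed.

Lemma trit_of_third a b c :
  (topp (tadd (trit_of a) (trit_of b)) == trit_of c) = (3 %| a + b + c).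
Proof.
rewrite /dvdn -modnDm -(modnDm a) /trit_of.
case: (a %% 3) (ltn_pmod a (isT : 0 < 3)) => [|[|[|]]] // _;
case: (b %% 3) (ltn_pmod b (isT : 0 < 3)) => [|[|[|]]] // _;
by case: (c %% 3) (ltn_pmod c (isT : 0 < 3)) => [|[|[|]]].
Qed.

Definition cls (ps : seq nat) a : point := [seq trit_of (logn q a) | q <- ps].

Fixpoint rep (ps : seq nat) (p : point) : nat :=
  match ps, p with
  | q :: ps', x :: p' => q ^ trit_nat x * rep ps' p'
  | _, _ => 1
  end.

Lemma logn_prod (ps : seq nat) (e : nat -> nat) r :
  uniq ps -> all prime ps ->
  logn r (\prod_(q <- ps) q ^ e q) = if r \in ps then e r else 0.
Proof.
elim: ps => [|q ps IH] /=; first by rewrite big_nil logn1.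
move=> /andP[qps ups] /andP[prq prs].
have pos : 0 < \prod_(q <- ps) q ^ e q.
  elim: ps prs {IH qps ups} => [|q' ps IH]; first by rewrite big_nil.
  by rewrite big_cons muln_gt0 expn_gt0 => /andP[/prime_gt0->] /IH->.
rewrite big_cons lognM ?expn_gt0 ?(prime_gt0 prq) // IH // lognX in_cons.
rewrite logn_prime //; case: eqP => [->|_]; last by rewrite muln0.
by rewrite (negPf qps) muln1 addn0.
Qed.

Lemma third_cls q qs a b : third (cls (q :: qs) a) (cls (q :: qs) b) =
  topp (tadd (trit_of (logn q a)) (trit_of (logn q b))) ::
    third (cls qs a) (cls qs b).
Proof. by []. Qed.

Section Classes.
Variable P : nat.
Hypothesis P0 : 0 < P.
Let ps := primes P.

Let ps_prime : all prime ps.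
Proof. by apply/allP => q; rewrite mem_primes; case/andP. Qed.
Let ps_uniq : uniq ps := primes_uniq P.

Lemma smooth_prod a : smooth P a -> a = \prod_(q <- ps) q ^ logn q a.
Proof.
move=> sa; have a0 : 0 < a by case/andP: sa.
have pos : 0 < \prod_(q <- ps) q ^ logn q a.
  rewrite big_seq; apply: prodn_cond_gt0 => q /(allP ps_prime)/prime_gt0 q0.
  by rewrite expn_gt0 q0.
apply: eqn_from_log => // r; rewrite logn_prod //.
case: ifP => // /negbT rP; apply/eqP; rewrite -leqn0 leqNgt logn_gt0.
apply: contra rP => ra; have /andP[_ /allP/(_ r ra)] := sa.
by rewrite inE.
Qed.

Lemma rep_cls a : rep ps (cls ps a) = \prod_(q <- ps) q ^ (logn q a %% 3).
Proof.
by elim: ps => [|q qs IH] /=; rewrite ?big_nil // big_cons IH trit_ofK.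
Qed.

Lemma smooth_rep a : smooth P a -> exists t, a = rep ps (cls ps a) * t ^ 3.
Proof.
move=> sa; exists (\prod_(q <- ps) q ^ (logn q a %/ 3)).
rewrite {1}(smooth_prod sa) rep_cls !expnS expn0 muln1 -!big_split.
by apply: eq_bigr => q _ /=; rewrite -!expnD; congr (_ ^ _); lia.
Qed.

Lemma cls_third a b c y : 0 < a -> 0 < b -> 0 < c -> a * b * c = y ^ 3 ->
  third (cls ps a) (cls ps b) = cls ps c.
Proof.
move=> a0 b0 c0 e; elim: ps => [//|q qs IH].
rewrite third_cls IH; apply/eqP; rewrite eqseq_cons trit_of_third eqxx andbT.
by rewrite -!lognM ?muln_gt0 ?a0 // e lognX dvdn_mulr.
Qed.

(** For smooth numbers the class records every prime that occurs, so collinearity makes all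
    exponents of the product multiples of 3. *)
Lemma cls_cube a b c : smooth P a -> smooth P b -> smooth P c ->
  third (cls ps a) (cls ps b) = cls ps c -> exists y, a * b * c = y ^ 3.
Proof.
move=> sa sb sc e.
have sabc : smooth P (a * b * c).
  by rewrite /smooth !pnatM -![pnat _ _]/(smooth P _) sa sb.
have H q : q \in ps -> 3 %| logn q (a * b * c).
  have [a0 b0 c0] : [/\ 0 < a, 0 < b & 0 < c].
    by split; [case/andP: sa | case/andP: sb | case/andP: sc].
  rewrite !lognM ?muln_gt0 ?a0 // -trit_of_third; elim: ps e => [//|r qs IH].
  rewrite third_cls => -[e1 e]; rewrite in_cons => /orP[/eqP->|]; last exact: IH.
  by rewrite e1.
exists (\prod_(q <- ps) q ^ (logn q (a * b * c) %/ 3)).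
rewrite {1}(smooth_prod sabc) !expnS expn0 muln1 -!big_split /=.
apply: eq_big_seq => q /H /dvdnP[k ->].
by rewrite mulnK // -!expnD; congr (_ ^ _); lia.
Qed.

Lemma size_cls a : cls ps a \in points (size ps).
Proof. by rewrite mem_points size_map. Qed.

Lemma uniq_triple (t : seq nat) : uniq t -> 2 < size t ->
  exists a b c, [/\ a \in t, b \in t, c \in t, a < b & b < c].
Proof.
move=> ut; rewrite -(size_sort leq).
have : sorted ltn (sort leq t).
  by rewrite ltn_sorted_uniq_leq sort_uniq ut sort_sorted //; apply: leq_total.
have mem x : (x \in t) = (x \in sort leq t) by rewrite mem_sort.
case E : (sort leq t) => [|a [|b [|c u]]] //= /and3P[ab bc _] _.
by exists a, b, c; rewrite !mem E !inE !eqxx ?orbT.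
Qed.

Section Upper.
Variables (x : nat) (s : seq nat).
Hypothesis ads : admissible (smooth P) x s.

Let fibre p := [seq a <- s | cls ps a == p].

(** Three numbers of the same class multiply to a cube, because [third p p] is p. *)
Lemma size_fibre p : size (fibre p) <= 2.
Proof.
have [us sD fs] := ads; rewrite leqNgt; apply/negP => lt.
have [a [b [c []]]] := uniq_triple (filter_uniq _ us) lt.
rewrite !mem_filter => /andP[/eqP ea aS] /andP[/eqP eb bS] /andP[/eqP ec cS] ab bc.
have sm d : d \in s -> smooth P d by move=> /sD/and3P[].
have [|y] := cls_cube (sm a aS) (sm b bS) (sm c cS); last exact: fs.
by rewrite ea eb ec third_id.
Qed.

Lemma size_fibres : size s = \sum_(p <- points (size ps)) size (fibre p).
Proof.
under eq_bigr do rewrite size_filter -sum1_count big_mkcond.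
rewrite exchange_big /= -sum1_size; apply: eq_bigr => a _.
apply: (etrans (esym
  (sum_pick (Q := xpredT) (fun=> 1) (uniq_points _) (size_cls a) isT))).
by apply: eq_bigr => p _; case: eqP.
Qed.

(* The smooth numbers of class p are the rep p * t ^ 3. *)
Lemma size_fibre_rep p :
  size (fibre p) <= (rep ps p <= x) + (2 ^ 3 * rep ps p <= x).
Proof.
have [us sD _] := ads; have := size_fibre p.
have uf : uniq (fibre p) by rewrite filter_uniq.
have H a : a \in fibre p -> exists2 t, 0 < t & a = rep ps p * t ^ 3 /\ a <= x.
  rewrite mem_filter => /andP[/eqP<- /sD/and3P[a0 ax sa]].
  have [t e] := smooth_rep sa; exists t => //.
  by case: t e => // e; move: a0; rewrite {1}e muln0.
case: (fibre p) uf H => [|a [|b [|]]] //=.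
  move=> _ /(_ a (mem_head _ _))[t t0 [e ax]] _; rewrite (leq_trans _ ax) // e.
  by rewrite leq_pmulr // expn_gt0 t0.
rewrite inE andbT => ab H _.
have [t t0 [ea ax]] := H a (mem_head _ _).
have [u u0 [eb bx]] : exists2 t, 0 < t & b = rep ps p * t ^ 3 /\ b <= x.
  by apply: H; rewrite !inE eqxx orbT.
(* The cofactors t and u are distinct, so one of them is at least 2. *)
suff le8 : 2 ^ 3 * rep ps p <= x.
  by rewrite le8 (leq_trans _ le8) // leq_pmull.
case: (leqP 2 t) => [t2|]; last case: (leqP 2 u) => [u2 _|].
- by rewrite (leq_trans _ ax) // ea mulnC leq_mul2l leq_exp2r // t2 orbT.
- by rewrite (leq_trans _ bx) // eb mulnC leq_mul2l leq_exp2r // u2 orbT.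
- move=> u1 t1; have [? ?] : t = 1 /\ u = 1 by lia.
  by move: ab; rewrite ea eb; subst t u; rewrite eqxx.
Qed.

Lemma cap_cls : cap (size ps) [in map (cls ps) s].
Proof.
have [us sD fs] := ads => _ _ _ _ /mapP[a aS ->] /mapP[b bS ->] ab.
apply/negP => /mapP[c cS e].
have sm d : d \in s -> smooth P d by move=> /sD/and3P[].
have [y ey] := cls_cube (sm a aS) (sm b bS) (sm c cS) e.
have anb : a != b by apply: contraNneq ab => ->.
have anc : a != c.
  apply: contraNneq ab => ac; rewrite -ac in e; apply/eqP.
  by apply: third_eql e; rewrite !size_map.
have bnc : b != c.
  apply: contraNneq ab => bc; rewrite -bc in e; apply/eqP.
  by apply: third_eqr e; rewrite !size_map.
(* One of the six orders of a, b, c is increasing and contradicts [triple_free]. *)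
have H a' b' c' : a' \in s -> b' \in s -> c' \in s ->
    a' * b' * c' = y ^ 3 -> a' < b' -> ~~ (b' < c').
  by move=> aS' bS' cS' e' lt; apply/negP => lt'; apply: (fs _ _ _ y aS' bS' cS').
have := H a b c aS bS cS; have := H a c b aS cS bS; have := H b a c bS aS cS.
have := H b c a bS cS aS; have := H c a b cS aS bS; have := H c b a cS bS aS.
by move: anb anc bnc; clear -ey; lia.
Qed.
End Upper.

Lemma maxfree_bounded x : maxfree (smooth P) x <= size (points (size ps)) * 2.
Proof.
have [s ads <-] := maxfree_ex (smooth P) x; rewrite (size_fibres s).
by apply: leq_sum_seq_const => p _; apply: (size_fibre ads).
Qed.

End Classes.

(** * Explicit caps for the modulus 210 *)

Local Open Scope Z_scope.

(** Points are numbered as in the certificates. In the last cap, of size 20, every representative is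
    at most 315, which yields weight 40 at 2520 = 8 * 315. *)
Definition caps : seq (seq point) := [seq map decode c | c <- [::
  [:: 0; 27; 9; 3; 36; 1; 30; 28; 12; 10; 39; 4; 37; 31; 13; 67];
  [:: 27; 9; 3; 1; 30; 63; 28; 12; 45; 10; 6; 39; 37; 2; 31; 13; 58; 40];
  [:: 27; 9; 3; 36; 1; 18; 30; 10; 6; 55; 39; 4; 37; 66; 31; 29; 13];
  [:: 0; 9; 3; 36; 30; 28; 12; 45; 10; 55; 4; 37; 2; 33; 66; 31; 40; 22; 16];
  [:: 0; 27; 9; 3; 36; 1; 10; 55; 39; 4; 37; 21; 33; 66; 31];
  [:: 0; 3; 36; 1; 18; 30; 63; 28; 12; 10; 39; 4; 37; 33; 29; 13; 58];
  [:: 0; 27; 9; 3; 36; 1; 57; 39; 4; 37; 19; 31; 15; 64; 48; 29; 13; 40; 34; 14];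
  [:: 0; 27; 9; 3; 1; 30; 63; 10; 39; 37; 21; 31; 29; 13; 46; 58; 42; 7; 40; 14];
  [:: 54; 3; 36; 63; 28; 12; 45; 57; 10; 6; 55; 39; 4; 31; 64; 29; 13; 40];
  [:: 27; 54; 63; 45; 39; 4; 37; 21; 66; 19; 31; 64; 48; 60; 46; 7; 56; 40; 5; 22]]].

(* In decreasing order: the g-th entry from the end is the least j such that
   some cap has weight g at j. *)
Definition attained : seq Z := [::
  2520; 1680; 1400; 840; 784; 560; 525; 480; 392; 280; 240; 210; 200; 168;
   140; 120; 105; 98; 80; 70; 60; 56; 48; 42; 40; 35; 30; 24; 21; 16; 15;
   14; 10; 8; 7; 6; 5; 3; 2; 1].

Definition valid_cap (s : seq point) :=
  [&& uniq s, all (fun p => size p == 4%N) s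
    & all (fun p => all (fun q => (p == q) || (third p q \notin s)) s) s].

Fixpoint check_attained (l : seq Z) :=
  if l is j :: l' then
    has (fun c => Z.of_nat (size l) <=? zsum c (weight j)) caps &&
    check_attained l'
  else true.

Lemma caps_ok : all valid_cap caps.
Proof. by vm_compute. Qed.

Lemma attained_ok : check_attained attained.
Proof. by vm_compute. Qed.

Local Close Scope Z_scope.

Lemma rep_pos qs p : all prime qs -> 0 < rep qs p.
Proof.
elim: qs p => [|q qs IH] [|t p] //= /andP[/prime_gt0 q0 /IH H].
by rewrite muln_gt0 expn_gt0 q0 H.
Qed.

Lemma logn_rep qs p r : all prime qs -> r \notin qs -> logn r (rep qs p) = 0.
Proof.
elim: qs p => [|q qs IH] [|t p] //=; rewrite ?logn1 // => /andP[prq prs].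
rewrite in_cons negb_or => /andP[rq rqs].
have q0 := prime_gt0 prq.
have R0 := rep_pos p prs.
by rewrite lognM ?expn_gt0 ?q0 // IH // lognX logn_prime // (negPf rq) muln0.
Qed.

Lemma cls_rep qs p : all prime qs -> uniq qs -> size p = size qs ->
  cls qs (rep qs p) = p.
Proof.
elim: qs p => [|q qs IH] [|t p] //= /andP[prq prs] /andP[qqs uqs] [sp].
have q0 := prime_gt0 prq; have R0 := rep_pos p prs.
have L r : logn r (q ^ trit_nat t * rep qs p) =
    trit_nat t * (r == q) + logn r (rep qs p).
  by rewrite lognM ?expn_gt0 ?q0 // lognX logn_prime.
rewrite /cls /= L eqxx muln1 logn_rep // addn0 trit_natK; congr cons.
rewrite -[RHS](IH p) //; apply/eq_in_map => r rqs; rewrite L.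
by case: eqP => [e|_]; [rewrite -e rqs in qqs | rewrite muln0].
Qed.

Lemma cls_cubeM qs m a : 0 < m -> 0 < a -> cls qs (m ^ 3 * a) = cls qs a.
Proof.
move=> m0 a0; apply/eq_map => q.
by rewrite lognM ?expn_gt0 ?m0 // lognX /trit_of mulnC modnMDl.
Qed.

Lemma smooth_rep_id P p : 0 < P -> smooth P (rep (primes P) p).
Proof.
move=> P0; have : all [in primes P] (primes P) by apply/allP.
elim: {2 3}(primes P) p => [|q qs IH] [|t p] //= /andP[qP qsP].
rewrite /smooth pnatM -[pnat _ (rep _ _)]/(smooth P _) IH // andbT.
have /and3P[prq _ _] : [&& prime q, 0 < P & q %| P] by rewrite -mem_primes.
by rewrite pnatX pnatE // inE; move: qP => /= ->.
Qed.

(** * The step function for the modulus 210 *)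

Definition nweight ps x p := (rep ps p <= x) + (2 ^ 3 * rep ps p <= x).

(** Both bounds for a class are kept: 2 gives the overall bound 40 through [cap4], and the weight
    feeds the certificates. *)
Lemma maxfree_cap P x : 0 < P -> exists2 C, cap (size (primes P)) C &
  maxfree (smooth P) x <=
    \sum_(p <- points (size (primes P)) | C p) minn 2 (nweight (primes P) x p).
Proof.
move=> P0; have [s ads <-] := maxfree_ex (smooth P) x.
exists [in map (cls (primes P)) s]; first exact: (cap_cls P0 ads).
rewrite (size_fibres P s) [leqRHS]big_mkcond; apply: leq_sum => p _ /=.
case: ifPn => [_|pC]; first by rewrite leq_min (size_fibre P0 ads) (size_fibre_rep P0 ads).
rewrite leqn0 size_eq0 -(negbK (_ == _)) -has_filter; apply: contra pC.
by case/hasP => a aS /eqP<-; apply: map_f.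
Qed.

Lemma primes210 : primes 210 = [:: 2; 3; 5; 7]. Proof. by []. Qed.

Lemma maxfree210_le40 x : maxfree (smooth 210) x <= 40.
Proof.
have [C capC le] := maxfree_cap x (isT : 0 < 210); apply: (leq_trans le).
rewrite primes210 in capC *; apply: (@leq_trans (count C (points 4) * 2)).
  rewrite -sum1_count big_distrl /=; apply: leq_sum => p _; exact: geq_minl.
by rewrite (leq_mul2r 2 _ 20) cap4.
Qed.

Lemma zrepE qs p : zrep (map Z.of_nat qs) p = Z.of_nat (rep qs p).
Proof.
elim: qs p => [|q qs IH] [|t p] //=; rewrite IH Nat2Z.inj_mul; congr Z.mul.
by case: t; rewrite /= ?expn0 ?expn1 // expnS expn1 Nat2Z.inj_mul.
Qed.

Lemma weightE x p : weight (Z.of_nat x) p = Z.of_nat (nweight (primes 210) x p).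
Proof.
have E : zrep zprimes p = Z.of_nat (rep [:: 2; 3; 5; 7] p).
  exact: (zrepE [:: 2; 3; 5; 7]).
rewrite /weight /nweight primes210 E; move: (rep _ p) => r.
rewrite Nat2Z.inj_add; congr Z.add.
  by case: Z.leb_spec; case: leqP => //; lia.
by case: Z.leb_spec; case: leqP => //; lia.
Qed.

Lemma zsumE (T : Type) (s : seq T) (f : T -> nat) :
  zsum s (fun p => Z.of_nat (f p)) = Z.of_nat (\sum_(p <- s) f p).
Proof. by elim: s => [|p s IH] /=; rewrite ?big_nil // big_cons Nat2Z.inj_add IH. Qed.

Lemma zsum_le (T : Type) (s : seq T) (f g : T -> Z) :
  (forall p, Z.le (f p) (g p)) -> Z.le (zsum s f) (zsum s g).
Proof. by move=> H; elim: s => [|p s IH] /=; [|have := H p]; lia. Qed.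

Lemma check_maxfree x j g c : Z.le (Z.of_nat x) j ->
  check (weight j) (Z.of_nat g) c [::] -> maxfree (smooth 210) x < g.
Proof.
move=> xj ok; have [C capC le] := maxfree_cap x (isT : 0 < 210).
rewrite primes210 in capC.
have := check_sound capC (I : holds C [::]) ok.
suff : Z.le (Z.of_nat (maxfree (smooth 210) x))
  (zsum (points 4) (fun p => Z.mul (weight j p) (indicator C p))) by lia.
apply: (@Z.le_trans _ (Z.of_nat (\sum_(p <- points 4) (nweight (primes 210) x p) * C p))).
  apply/inj_le/leP/(leq_trans le); rewrite primes210 big_mkcond /=.
  by apply: leq_sum => p _; case: (C p); rewrite ?muln1 ?muln0 // geq_minr.
rewrite -zsumE; apply: zsum_le => p; rewrite Nat2Z.inj_mul -weightE.
(* The weight grows with its first argument, so a certificate at j serves all x <= j. *)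
have : Z.le (weight (Z.of_nat x) p) (weight j p).
  rewrite /weight; case: Z.leb_spec; case: Z.leb_spec;
  by case: Z.leb_spec; case: Z.leb_spec; lia.
by rewrite /indicator; case: (C p) => /=; lia.
Qed.

Definition jumps (l : seq (Z * cert)) := [seq Z.to_nat e.1 | e <- l].

(** Here g entries have been consumed already. An entry j > x certifies that [maxfree] at x is at
    most g, so the left side is 0; truncation at the length of l makes the induction start. *)
Lemma check_jumps_sound l g x : check_jumps (Z.of_nat g.+1) l ->
  minn (size l) (maxfree (smooth 210) x - g) <= \sum_(j <- jumps l) (j <= x).
Proof.
elim: l g => [|[j c] l IH] g /=; first by rewrite big_nil min0n.
case/andP => ok okl; rewrite big_cons /=.
have {IH}H := IH g.+1; case: (leqP (Z.to_nat j) x) => jx /=.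
  have : minn (size l) (maxfree (smooth 210) x - g.+1) <= \sum_(j <- jumps l) (j <= x).
    apply: H; suff -> : Z.of_nat g.+2 = Z.add (Z.of_nat g.+1) 1 by [].
    by lia.
  by lia.
have lt : maxfree (smooth 210) x < g.+1.
  by apply: (@check_maxfree x (Z.sub j 1) g.+1 c _ ok); lia.
by have -> : maxfree (smooth 210) x - g = 0 by lia.
Qed.

Lemma maxfree210_upper x :
  maxfree (smooth 210) x <= \sum_(j <- jumps certs) (j <= x).
Proof.
have := check_jumps_sound (g := 0) x certs_ok.
rewrite subn0 (_ : size certs = 40) //.
by have := maxfree210_le40 x; rewrite /minn; case: ltnP => //; lia.
Qed.

Lemma valid_cap_maxfree s x : valid_cap s ->
  \sum_(p <- s) nweight (primes 210) x p <= maxfree (smooth 210) x.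
Proof.
case/and3P => us /allP sz /allP capS; set ps := primes 210.
have szp p : p \in s -> size p = size ps by move/sz/eqP.
have prs : all prime ps by [].
have ups : uniq ps by [].
have R0 p : 0 < rep ps p by apply: rep_pos.
have R8 p : 0 < 2 ^ 3 * rep ps p by rewrite muln_gt0 R0.
pose s1 := [seq rep ps p | p <- s & rep ps p <= x].
pose s8 := [seq 2 ^ 3 * rep ps p | p <- s & 2 ^ 3 * rep ps p <= x].
have memP a : a \in s1 ++ s8 -> exists2 p, p \in s &
    [/\ cls ps a = p, 0 < a, a <= x, smooth 210 a & a = rep ps p \/ a = 2 ^ 3 * rep ps p].
  rewrite mem_cat => /orP[] /mapP[p]; rewrite mem_filter => /andP[px pS ->]; exists p => //.
    by split; [rewrite cls_rep ?szp|exact: R0|exact: px|exact: smooth_rep_id|left].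
  split; [by rewrite cls_cubeM // cls_rep ?szp|exact: R8|exact: px| |by right].
  by rewrite /smooth pnatM -[pnat _ (rep _ _)]/(smooth 210 _) smooth_rep_id.
have -> : \sum_(p <- s) nweight ps x p = size (s1 ++ s8).
  rewrite size_cat !size_map !size_filter -!sum1_count big_split /=.
  by congr addn; rewrite [RHS]big_mkcond; apply: eq_bigr => p _; case: leqP.
have inj1 : {in s &, injective (rep ps)}.
  by move=> p q pS qS e; rewrite -[p](cls_rep prs ups (szp p pS)) e cls_rep ?szp.
apply: maxfree_ge; split.
- rewrite cat_uniq !map_inj_in_uniq ?filter_uniq ?andTb ?andbT //.
  + apply/hasPn => a /mapP[p]; rewrite mem_filter => /andP[_ pS] ea.
    apply/negP => /mapP[q]; rewrite mem_filter => /andP[_ qS] ea'.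
    have pq : p = q.
      rewrite -[q](cls_rep prs ups (szp q qS)) -ea' ea cls_cubeM //.
      by rewrite cls_rep ?szp.
    by move: (R0 q); rewrite ea' -pq in ea; rewrite -pq; lia.
  + move=> p q; rewrite !mem_filter => /andP[_ pS] /andP[_ qS] e.
    by apply: inj1 => //; lia.
  + move=> p q; rewrite !mem_filter => /andP[_ pS] /andP[_ qS]; exact: inj1.
- by move=> a /memP[p pS [_ -> -> -> _]].
- move=> a b c y /memP[p pS [ea a0 _ _ aE]] /memP[q qS [eb b0 _ _ bE]].
  move=> /memP[r rS [ec c0 _ _ cE]] ab bc e.
  have := cls_third 210 a0 b0 c0 e; rewrite ea eb ec => e3.
  (* Collinear points of a cap coincide, so three increasing numbers would lie in {r, 8 r}. *)
  have /allP/(_ q qS) := capS p pS; rewrite e3 rS orbF => /eqP pq.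
  rewrite -pq third_id in e3; rewrite -pq in bE; rewrite -e3 in cE.
  by move: (R0 p); lia.
Qed.

(** At the first entry j <= x, the number of entries from j on is at most the weight of some cap at
    j, and [maxfree] is monotone. *)
Lemma maxfree210_lower x :
  \sum_(j <- map Z.to_nat attained) (j <= x) <= maxfree (smooth 210) x.
Proof.
elim: attained attained_ok => [|j l IH]; first by rewrite big_nil.
move=> /andP[/hasP[c cI /Z.leb_le le] /IH{}IH]; rewrite big_cons.
case: (leqP (Z.to_nat j) x) => jx; last by [].
apply: (@leq_trans (size l).+1).
  rewrite add1n ltnS -[leqRHS](size_map Z.to_nat) -sum1_size.
  by apply: leq_sum => i _; apply: leq_b1.
apply: leq_trans (maxfree_homo _ jx).
apply: leq_trans (valid_cap_maxfree _ (allP caps_ok _ cI)).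
apply/leP/Nat2Z.inj_le; apply: (Z.le_trans _ _ _ le).
rewrite -zsumE; apply: zsum_le => p; rewrite -weightE.
by rewrite /weight; do 4 case: Z.leb_spec; lia.
Qed.

(** * Asymptotics *)

Import Order.TTheory GRing.Theory Num.Theory.
Import numFieldNormedType.Exports.

Local Open Scope ring_scope.

Section Asymptotics.
Variable R : realType.

(** Coprimality to P has period P. *)
Lemma sum_coprime_blocks P N (f : nat -> R) :
  \sum_(0 <= k < P * N | coprime k P) f k =
  \sum_(0 <= j < N) \sum_(0 <= r < P | coprime r P) f (P * j + r)%N.
Proof.
elim: N => [|N IH]; first by rewrite muln0 !big_geq.
rewrite big_nat_recr //= -IH mulnS addnC.
rewrite (big_cat_nat (n := (P * N)%N)) ?leq_addr //=; congr (_ + _).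
rewrite -{1}[(P * N)%N]add0n big_addn addKn; apply: congr_big_nat => // i.
  by move=> _; rewrite ![coprime _ P]coprime_sym /coprime addnC mulnC gcdnMDl.
by rewrite addnC.
Qed.

Lemma sum_coprime_const P (c : R) :
  \sum_(0 <= r < P | coprime r P) c = (totient P)%:R * c.
Proof.
rewrite -[c in LHS]mul1r -big_distrl /=; congr (_ * _).
rewrite totient_count_coprime natr_sum [LHS]big_mkcond /=.
by apply: eq_bigr => r _; rewrite coprime_sym; case: coprime.
Qed.

Definition ncop P y : R := \sum_(1 <= v < y.+1 | coprime v P) 1.

(** Comparison with the multiples of P on both sides of y: each period contains [totient P] numbers
    coprime to P. *)
Lemma ncop_bounds P y : (1 < P)%N ->
  (totient P)%:R / P%:R * y%:R - (totient P)%:R <= ncop P y <=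
  (totient P)%:R / P%:R * y%:R + (totient P)%:R.
Proof.
move=> P1; set t : R := (totient P)%:R.
have P0 : 0 < P%:R :> R by rewrite ltr0n ltnW.
have t0 : 0 <= t by rewrite ler0n.
have blocks N : \sum_(0 <= k < P * N | coprime k P) 1 = N%:R * t :> R.
  rewrite sum_coprime_blocks; under eq_bigr do rewrite sum_coprime_const mulr1.
  by rewrite sumr_const_nat subn0 mulr_natl.
(* The added term 0 is not counted, since gcd(0, P) = P > 1. *)
have -> : ncop P y = \sum_(0 <= v < y.+1 | coprime v P) 1.
  rewrite [RHS]big_ltn_cond // /coprime gcd0n; case: eqP => // e.
  by rewrite e in P1.
have mono a b : (a <= b)%N -> \sum_(0 <= k < a | coprime k P) 1 <=
    \sum_(0 <= k < b | coprime k P) 1 :> R.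
  by move=> ab; rewrite [leRHS](big_cat_nat (n := a)) //= lerDl sumr_ge0.
have ediv : y%:R = (y %/ P)%:R * P%:R + (y %% P)%:R :> R.
  by rewrite {1}(divn_eq y P) natrD natrM.
have mod0 : 0 <= (y %% P)%:R :> R by rewrite ler0n.
have modP : (y %% P)%:R <= P%:R :> R by rewrite ler_nat ltnW // ltn_pmod // ltnW.
set q : R := (y %/ P)%:R in ediv.
have e : t / P%:R * y%:R = q * t + t * ((y %% P)%:R / P%:R).
  by rewrite ediv; field; rewrite gt_eqF.
have f0 : 0 <= (y %% P)%:R / P%:R :> R by rewrite divr_ge0 // ltW.
have f1 : (y %% P)%:R / P%:R <= 1 :> R by rewrite ler_pdivrMr // mul1r.
apply/andP; split.
  apply: (@le_trans _ _ (q * t)); first by rewrite e; nra.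
  rewrite -blocks; apply: mono; rewrite mulnC.
  by rewrite (leq_trans (leq_divM y P)).
apply: (@le_trans _ _ ((y %/ P).+1%:R * t)); last first.
  by rewrite e -natr1 -/q; nra.
rewrite -blocks; apply: mono.
by rewrite mulnC ltn_ceil // ltnW.
Qed.

(** Both j <= n / v and v <= n / j say that v j <= n. *)
Lemma sum_steps P (js : seq nat) n : all (leq 1) js ->
  (\sum_(1 <= v < n.+1 | coprime v P) \sum_(j <- js) (j <= n %/ v)%N)%N%:R =
  \sum_(j <- js) ncop P (n %/ j).
Proof.
move=> /allP j0; rewrite exchange_big natr_sum /=.
apply: eq_big_seq => j /j0 {}j0; rewrite natr_sum /ncop.
rewrite [RHS](big_nat_widen _ _ n.+1) ?ltnS ?leq_div //.
rewrite big_nat_cond [RHS]big_nat_cond big_mkcond [RHS]big_mkcond.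
apply: eq_bigr => v _ /=.
case: (ltnP 0 v) => v0; rewrite ?andbF //=.
rewrite [(v < (n %/ j).+1)%N]ltnS !leq_divRL // mulnC.
by case: (v < n.+1)%N; case: coprime; case: (v * j <= n)%N.
Qed.

(** Rounding n / j costs at most another [totient P] per jump, hence the factor 2 in K, which is
    independent of n. *)
Lemma sum_ncop P (js : seq nat) n : (1 < P)%N -> all (leq 1) js ->
  let c := (totient P)%:R / P%:R * \sum_(j <- js) j%:R^-1 in
  let K := 2 * (totient P)%:R * (size js)%:R in
  c * n%:R - K <= \sum_(j <- js) ncop P (n %/ j) <= c * n%:R + K.
Proof.
move=> P1 /=; have P0 : 0 < P%:R :> R by rewrite ltr0n ltnW.
set t : R := (totient P)%:R; have t0 : 0 <= t by rewrite ler0n.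
have tP : 0 <= t / P%:R <= t.
  rewrite divr_ge0 ?(ltW P0) //= ler_pdivrMr // ler_peMr // ler1n.
  exact: ltnW.
elim: js => [|j js IH] /=; first by rewrite !big_nil !mulr0 mul0r addr0 subr0 lexx.
case/andP => j0 /IH{IH}; rewrite !big_cons -[(size js).+1%:R]natr1.
have J0 : 0 < j%:R :> R by rewrite ltr0n.
have := ncop_bounds (n %/ j) P1; rewrite -/t.
have ediv : n%:R = (n %/ j)%:R * j%:R + (n %% j)%:R :> R.
  by rewrite {1}(divn_eq n j) natrD natrM.
have mod0 : 0 <= (n %% j)%:R / j%:R :> R by rewrite divr_ge0 // ler0n.
have modP : (n %% j)%:R / j%:R <= 1 :> R.
  by rewrite ler_pdivrMr // mul1r ler_nat ltnW // ltn_pmod.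
have e : t / P%:R * (n %/ j)%:R =
    t / P%:R * j%:R^-1 * n%:R - t / P%:R * ((n %% j)%:R / j%:R).
  by rewrite ediv; field; rewrite !gt_eqF.
move: e tP; set a := t / P%:R; set d := (n %% j)%:R / j%:R in mod0 modP *.
move=> -> /andP[a0 at_] /andP[l1 u1] /andP[l2 u2].
have h1 : 0 <= a * d by rewrite mulr_ge0.
have h2 : a * d <= t by rewrite (le_trans _ at_) // ler_piMr.
rewrite !mulrDl !mulrDr mulr1; apply/andP; split; lra.
Qed.
End Asymptotics.

(** Induction on the bound: g is cut off at B, and the remaining jump is the least j with g j >
    B. *)
Lemma step_function (g : nat -> nat) B : {homo g : x y / (x <= y)%N} ->
  g 0 = 0%N -> (forall x, (g x <= B)%N) ->
  exists2 js, all (leq 1) js & forall x, g x = (\sum_(j <- js) (j <= x))%N.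
Proof.
elim: B g => [|B IH] g gh g0 gB.
  by exists [::] => // x; rewrite big_nil; apply/eqP; rewrite -leqn0.
have [||x|js js0 gE] := IH (fun x => minn (g x) B).
- by move=> x y /gh; lia.
- by rewrite g0 min0n.
- exact: geq_minr.
case: (pselect (exists x, (B < g x)%N)) => [ex|nex]; last first.
  exists js => // x; rewrite -gE; apply/esym/minn_idPl; rewrite leqNgt.
  by apply/negP => lt; apply: nex; exists x.
case: (ex_minnP ex) => j jB jmin; exists (j :: js) => [|x].
  by rewrite /= js0 andbT lt0n; apply: contraTneq jB => ->; rewrite g0.
rewrite big_cons -gE; case: (leqP j x) => jx /=.
  by have := gh _ _ jx; have := gB x; lia.
have : ~~ (B < g x)%N by apply: contraTN jx => /jmin; rewrite -leqNgt.
by have := gB x; lia.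
Qed.

Lemma coprime_fact_gt k m : (1 < m)%N -> coprime m k`! -> (k < m)%N.
Proof.
move=> m1 c; rewrite ltnNge; apply/negP => mk.
have : (m %| 1)%N by rewrite -(eqP c) dvdn_gcd dvdnn dvdn_fact // mk ltnW.
by rewrite dvdn1 => /eqP e; rewrite e in m1.
Qed.

(** * Existence of the limit *)

Section Limit.
Variable R : realType.

(** Telescoping with 1 / m^2 <= 1 / (m - 1) - 1 / m. *)
Lemma inv_square_tail a N : (1 < a)%N ->
  \sum_(a <= m < N) (m%:R ^+ 2)^-1 <= (a.-1%:R)^-1 :> R.
Proof.
move=> a1; case: (leqP N a) => [Na|aN]; first by rewrite big_geq // invr_ge0.
have pos n : (0 < n)%N -> 0 < n%:R :> R by rewrite ltr0n.
suff H k : \sum_(a <= m < a + k) (m%:R ^+ 2)^-1 <=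
    (a.-1%:R)^-1 - ((a + k).-1%:R)^-1 :> R.
  rewrite -(subnKC (ltnW aN)) (le_trans (H _)) // lerBlDr lerDl invr_ge0 ler0n //.
elim: k => [|k IH]; first by rewrite addn0 big_geq // subrr.
rewrite addnS big_nat_recr ?leq_addr //=.
have [b e b0] : exists2 b, (a + k = b.+1)%N & (0 < b)%N.
  by exists (a + k).-1; [lia | lia].
move: IH; rewrite e /= => IH; have B0 := pos b b0.
apply: (le_trans (lerD IH (lexx _))).
suff : (b.+1%:R ^+ 2)^-1 <= b%:R^-1 - b.+1%:R^-1 :> R.
  by move: (_ ^-1) b%:R^-1 b.+1%:R^-1 a.-1%:R^-1 => x y z t; lra.
have -> : b%:R^-1 - b.+1%:R^-1 = (b%:R * b.+1%:R)^-1 :> R.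
  by rewrite -natr1; field; rewrite !gt_eqF // addr_gt0.
rewrite lef_pV2 ?posrE ?mulr_gt0 ?exprn_gt0 ?pos // expr2.
by rewrite ler_pM2r ?pos // ler_nat.
Qed.

(** Passes from inequalities up to O(1) to the coefficients of n. *)
Lemma le0_of_bounded (a K : R) N :
  (forall n, (N <= n)%N -> a * n%:R <= K) -> a <= 0.
Proof.
move=> H; rewrite leNgt; apply/negP => a0.
have := H (N + Num.bound `|K / a|%R)%N (leq_addr _ _).
rewrite leNgt => /negP; apply; rewrite mulrC -ltr_pdivrMr //.
apply: (le_lt_trans (ler_norm _)).
apply: (lt_le_trans (archi_boundP (normr_ge0 _))).
by rewrite ler_nat leq_addl.
Qed.

Local Notation u n := ((F 3 3 n)%:R : R).

Lemma u_le n : u n <= n%:R.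
Proof. by rewrite ler_nat F_maxfree maxfree_le. Qed.

Lemma div_square_le n m : (0 < m)%N ->
  (n %/ m ^ 2)%:R <= n%:R * (m%:R ^+ 2)^-1 :> R.
Proof.
move=> m0; rewrite ler_pdivlMr ?exprn_gt0 ?ltr0n // -natrX -natrM ler_nat.
exact: leq_divM.
Qed.

(** With P = k!, the term m = 1 of [maxfree_lower] is F n itself; all others have m > k, and F(n /
    m^2) <= n / m^2 makes their sum at most n / k. *)
Lemma F_approx k : (1 < k)%N -> exists2 c : R, 0 <= c &
  exists K : R, forall n, u n <= c * n%:R + K /\
    c * n%:R - K <= u n + n%:R / k%:R.
Proof.
move=> k1; set P := k`!; have P0 : (0 < P)%N by rewrite fact_gt0.
have P1 : (1 < P)%N.
  by apply: (leq_trans k1); apply: dvdn_leq => //; rewrite dvdn_fact // leqnn ltnW.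
have [||x|js js0 gE] := @step_function (maxfree (smooth P))
    (size (points (size (primes P))) * 2).
- by move=> x y; apply: maxfree_homo.
- by apply/eqP; rewrite -leqn0 maxfree_le.
- exact: maxfree_bounded.
exists ((totient P)%:R / P%:R * \sum_(j <- js) j%:R^-1).
  rewrite mulr_ge0 ?divr_ge0 ?ler0n //; apply: sumr_ge0 => j _.
  by rewrite invr_ge0 ler0n.
exists (2 * (totient P)%:R * (size js)%:R) => n.
have /andP[lo up] := @sum_ncop R P js n P1 js0.
have UE : (\sum_(1 <= v < n.+1 | coprime v P) maxfree (smooth P) (n %/ v))%:R =
    \sum_(j <- js) ncop R P (n %/ j).
  by rewrite -sum_steps //; congr _%:R; apply: eq_bigr => v _; rewrite gE.
split.
  by apply: le_trans up; rewrite -UE ler_nat F_maxfree; apply: maxfree_upper.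
apply: (le_trans lo); rewrite -UE.
have /(_ n) := maxfree_lower P0; rewrite -(ler_nat R) => /le_trans; apply.
case: n {lo up UE} => [|n].
  by rewrite big_geq // addr_ge0 ?divr_ge0 ?ler0n.
rewrite natr_sum big_ltn_cond //= /coprime gcd1n eqxx exp1n divn1 -F_maxfree lerD2l.
apply: (@le_trans _ _ (\sum_(2 <= m < n.+2 | (k < m)%N)
    n.+1%:R * (m%:R ^+ 2)^-1)).
  rewrite big_nat_cond [leRHS]big_nat_cond big_mkcond [leRHS]big_mkcond.
  apply: ler_sum => m _; case: andP => [[/andP[m1 mn] c]|_]; last first.
    by case: ifP => // _; rewrite mulr_ge0 ?invr_ge0 ?exprn_ge0 ?ler0n.
  rewrite m1 mn (coprime_fact_gt m1 c) -F_maxfree.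
  by rewrite (le_trans (u_le _)) // div_square_le // ltnW.
rewrite -(big_nat_widenl k.+1 2 n.+2 xpredT) //; last exact: leqW.
rewrite -big_distrr /=; apply: ler_wpM2l; first by rewrite ler0n.
by apply: inv_square_tail; rewrite ltnS ltnW.
Qed.

(** The limit is the infimum of the constants of [F_approx]: each bounds F from above up to O(1),
    and one with large k bounds it from below up to n / k. *)
Lemma F_limit : exists C : R, forall eps, 0 < eps ->
  exists N, forall n, (N <= n)%N ->
    (C - eps) * n%:R <= u n <= (C + eps) * n%:R.
Proof.
pose S : set R := fun c => exists k (K : R), [/\ (1 < k)%N, 0 <= c &
  forall n, u n <= c * n%:R + K /\ c * n%:R - K <= u n + n%:R / k%:R].
have Sk k : (1 < k)%N -> exists2 c, S c & exists K : R,
    forall n, u n <= c * n%:R + K /\ c * n%:R - K <= u n + n%:R / k%:R.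
  by move=> k1; have [c c0 [K H]] := F_approx k1; exists c; [exists k, K|exists K].
have infS : has_inf S.
  split; first by have [c Sc _] := Sk 2%N isT; exists c.
  by exists 0 => c [k [K []]].
have large (K e : R) : 0 < e -> exists N, forall n, (N <= n)%N -> K <= e * n%:R.
  move=> e0; exists (Num.bound `|K / e|) => n; rewrite -(ler_nat R) => Nn.
  rewrite mulrC -ler_pdivrMr // (le_trans (ler_norm _)) // (le_trans _ Nn) //.
  exact/ltW/archi_boundP.
exists (inf S) => eps eps0; have e2 : 0 < eps / 2 by rewrite divr_gt0.
have [c Sc cC] := inf_adherent e2 infS.
have [k [K [k1 c0 H]]] := Sc.
(* Makes 1 / l at most eps / 2; the two successors ensure l > 1. *)
pose l := (Num.bound (2 / eps)).+2.
have [d Sd [L HL]] := Sk l isT.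
have Cd : inf S <= d by apply: ge_inf => //; case: infS.
have linv : l%:R^-1 <= eps / 2.
  rewrite -[leRHS]invrK lef_pV2 ?posrE ?invr_gt0 ?ltr0n // invf_div.
  have : 2 / eps < (Num.bound (2 / eps))%:R :> R.
    by apply: archi_boundP; rewrite divr_ge0 // ltW.
  by move/ltW/le_trans; apply; rewrite ler_nat (leq_trans (leqnSn _) (leqnSn _)).
have [N1 HN1] := large K _ e2; have [N2 HN2] := large L _ e2.
exists (maxn N1 N2) => n; rewrite geq_max => /andP[/HN1 h1 /HN2 h2].
have [h3 _] := H n; have [_ h4] := HL n.
have n0 : 0 <= n%:R :> R by rewrite ler0n.
have h5 : n%:R / l%:R <= n%:R * (eps / 2) by rewrite ler_wpM2l.
have h6 : c * n%:R <= (inf S + eps / 2) * n%:R by rewrite ler_wpM2r // ltW.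
have h7 : inf S * n%:R <= d * n%:R by rewrite ler_wpM2r.
by apply/andP; split; lra.
Qed.
End Limit.

(** * Numerical sums of reciprocals *)

Local Open Scope Z_scope.

Definition residues210 : seq nat := [seq r <- iota 0 210 | coprime r 210].

Definition squares210 : seq Z :=
  [seq (let z := 210 * Z.of_nat j + Z.of_nat r in z * z)
     | j <- iota 0 100, r <- residues210].

(* Comparisons of sums of inverses with a fraction [a / b], after rounding
   each term to a multiple of [1 / D]. *)
Definition inv_sum_le (l : seq Z) (D a b : Z) :=
  [&& all (Z.ltb 0) l, 0 <? D, 0 <? b
    & zsum l (fun j => D / j + 1) * b <=? a * D].

Definition inv_sum_ge (l : seq Z) (D a b : Z) :=
  [&& all (Z.ltb 0) l, 0 <? D, 0 <? b
    & a * D <=? zsum l (fun j => D / j) * b].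

(** The longest list has 48 * 100 terms, so rounding costs at most 4800 / 10^12, below the seven
    decimals of the fractions. *)
Definition scale := 1000000000000.

(** The product 3.122 * 48 / 210 is exactly 0.7136. *)
Lemma jumps_inv_sum : inv_sum_le (map fst certs) scale 3122 1000.
Proof. by vm_compute. Qed.

(** These jumps differ from those of [certs] only for the values 38 and 40 (1400 against 1176, 2520
    against 1960), so the two sums nearly agree. *)
Lemma attained_inv_sum : inv_sum_ge attained scale 31217488 10000000.
Proof. by vm_compute. Qed.

Lemma squares210_inv_sum : inv_sum_le squares210 scale 10312621 10000000.
Proof. by vm_compute. Qed.

Local Close Scope Z_scope.

Section Numerics.
Variable R : realType.

Definition zval (z : Z) : R := (Z.to_nat z)%:R.

(** Binary evaluation, which avoids unfolding large constants into unary naturals. *)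
Fixpoint pval (p : positive) : R :=
  match p with
  | xH => 1
  | xO q => 2 * pval q
  | xI q => 1 + 2 * pval q
  end.

Lemma zval_pos p : zval (Zpos p) = pval p.
Proof.
rewrite /zval /=; elim: p => [p IH|p IH|] //=; rewrite -IH.
  by rewrite Pos2Nat.inj_xI -natrM -nat1r.
by rewrite Pos2Nat.inj_xO -natrM.
Qed.

Lemma zvalD x y : Z.le 0 x -> Z.le 0 y -> zval (Z.add x y) = zval x + zval y.
Proof. by move=> x0 y0; rewrite /zval Z2Nat.inj_add // natrD. Qed.

Lemma zvalM x y : Z.le 0 x -> Z.le 0 y -> zval (Z.mul x y) = zval x * zval y.
Proof. by move=> x0 y0; rewrite /zval Z2Nat.inj_mul // natrM. Qed.

Lemma zval_le x y : Z.le x y -> zval x <= zval y.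
Proof. by move=> xy; rewrite ler_nat; lia. Qed.

Lemma zval_gt0 x : Z.lt 0 x -> 0 < zval x.
Proof. by move=> x0; rewrite ltr0n; lia. Qed.

Lemma inv_sum_le_sound l D a b : inv_sum_le l D a b -> Z.le 0 a ->
  \sum_(j <- l) (zval j)^-1 <= zval a / zval b.
Proof.
case/and4P => l0 /Z.ltb_lt D0 /Z.ltb_lt b0 /Z.leb_le le a0.
have Dv := zval_gt0 D0; have bv := zval_gt0 b0.
have H : Z.le 0 (zsum l (fun j => Z.add (Z.div D j) 1)) /\
  (\sum_(j <- l) (zval j)^-1) * zval D <=
    zval (zsum l (fun j => Z.add (Z.div D j) 1)).
  elim: l l0 {le} => [_|j l IH /andP[/Z.ltb_lt j0 /IH[h0 h]]] /=.
    by rewrite big_nil mul0r; split; [lia | rewrite ler0n].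
  have q0 : Z.le 0 (Z.div D j) by apply: Z.div_pos; lia.
  split; first by lia.
  rewrite big_cons mulrDl zvalD; [|lia|lia]; apply: lerD => //.
  rewrite mulrC ler_pdivrMr ?zval_gt0 // -zvalM; [|lia|lia].
  by apply: zval_le; have := Z.mod_pos_bound D j j0; have := Z.div_mod D j; nia.
case: H => h0 h; rewrite ler_pdivlMr // -(ler_pM2r Dv) mulrAC.
apply: (le_trans (ler_wpM2r (ltW bv) h)).
by rewrite -!zvalM; [apply: zval_le|lia..].
Qed.

Lemma inv_sum_ge_sound l D a b : inv_sum_ge l D a b -> Z.le 0 a ->
  zval a / zval b <= \sum_(j <- l) (zval j)^-1.
Proof.
case/and4P => l0 /Z.ltb_lt D0 /Z.ltb_lt b0 /Z.leb_le le a0.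
have Dv := zval_gt0 D0; have bv := zval_gt0 b0.
have H : Z.le 0 (zsum l (Z.div D)) /\
  zval (zsum l (Z.div D)) <= (\sum_(j <- l) (zval j)^-1) * zval D.
  elim: l l0 {le} => [_|j l IH /andP[/Z.ltb_lt j0 /IH[h0 h]]] /=.
    by rewrite big_nil mul0r; split; [lia | rewrite /zval].
  have q0 : Z.le 0 (Z.div D j) by apply: Z.div_pos; lia.
  split; first by lia.
  rewrite big_cons mulrDl zvalD; [|lia|lia]; apply: lerD => //.
  rewrite [leRHS]mulrC ler_pdivlMr ?zval_gt0 // -zvalM; [|lia|lia].
  by apply: zval_le; have := Z.mul_div_le D j j0; lia.
case: H => h0 h; rewrite ler_pdivrMr // -(ler_pM2r Dv) mulrAC.
apply: le_trans (ler_wpM2r (ltW bv) h).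
by rewrite -!zvalM; [apply: zval_le|lia..].
Qed.

Lemma pval_literals : [/\ pval 3122 = 3122, pval 1000 = 1000,
  pval 31217488 = ((31 * 100 + 21) * 100 + 74) * 100 + 88,
  pval 10312621 = ((10 * 100 + 31) * 100 + 26) * 100 + 21
  & pval 10000000 = 10 * 100 * 100 * 100].
Proof. by split; rewrite /=; ring. Qed.

Lemma jumps_bound : \sum_(j <- jumps certs) j%:R^-1 <= 3122 / 1000 :> R.
Proof.
have := inv_sum_le_sound jumps_inv_sum (Zle_0_pos _); rewrite !zval_pos.
by have [-> -> _ _ _] := pval_literals; rewrite /zval /jumps !big_map.
Qed.

Lemma attained_bound :
  (((31 * 100 + 21) * 100 + 74) * 100 + 88) / (10 * 100 * 100 * 100) <=
    \sum_(j <- map Z.to_nat attained) j%:R^-1 :> R.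
Proof.
have := inv_sum_ge_sound attained_inv_sum (Zle_0_pos _); rewrite !zval_pos.
by have [_ _ -> _ ->] := pval_literals; rewrite /zval big_map.
Qed.

Lemma squares_bound :
  \sum_(1 <= m < 210 * 100 | coprime m 210) (m%:R ^+ 2)^-1
    <= (((10 * 100 + 31) * 100 + 26) * 100 + 21) / (10 * 100 * 100 * 100) :> R.
Proof.
have -> : \sum_(1 <= m < 210 * 100 | coprime m 210) (m%:R ^+ 2)^-1 =
    \sum_(j <- squares210) (zval j)^-1.
  transitivity (\sum_(0 <= m < 210 * 100 | coprime m 210) (m%:R ^+ 2)^-1 : R).
    by rewrite [RHS]big_ltn_cond.
  rewrite sum_coprime_blocks /squares210 big_allpairs_dep.
  rewrite /index_iota subn0; apply: eq_bigr => j _.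
  rewrite subn0 /residues210 big_filter; apply: eq_bigr => r _.
  rewrite -natrX /zval; congr ((_%:R)^-1); lia.
have := inv_sum_le_sound squares210_inv_sum (Zle_0_pos _); rewrite !zval_pos.
by have [_ _ _ -> ->] := pval_literals.
Qed.

(** Each m = P j + r is at least P j, each block has [totient P] admissible r, and the sum of 1 /
    j^2 over j >= k is at most 1 / (k - 1). *)
Lemma squares_tail P k n : (0 < P)%N -> (1 < k)%N ->
  \sum_(P * k <= m < n | coprime m P) (m%:R ^+ 2)^-1
    <= (totient P)%:R * ((P%:R ^+ 2)^-1 * k.-1%:R^-1) :> R.
Proof.
move=> P0 k1.
(* Zero below k, so that the sum can run over complete blocks starting at 0. *)
pose f j : R := if (j < k)%N then 0 else (P%:R ^+ 2)^-1 * (j%:R ^+ 2)^-1.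
have B0 j : 0 <= (j%:R ^+ 2)^-1 :> R by rewrite invr_ge0 exprn_ge0 ?ler0n.
have f0 j : 0 <= f j.
  by rewrite /f; case: ifP => _; [exact: lexx | exact: mulr_ge0 (B0 _) (B0 _)].
apply: (@le_trans _ _ (\sum_(0 <= m < P * n | coprime m P) f (m %/ P)%N)).
  case: (leqP (P * k) n) => nk; last first.
    by rewrite big_geq ?(ltnW nk) // sumr_ge0.
  have nP : (n <= P * n)%N by rewrite leq_pmull.
  rewrite [leRHS](big_cat_nat (n := (P * k)%N)) //=; last exact: leq_trans nP.
  rewrite [X in _ <= _ + X](big_cat_nat (n := n)) //=.
  rewrite -[leLHS]add0r; apply: lerD; first exact: sumr_ge0.
  rewrite -[leLHS]addr0; apply: lerD; last exact: sumr_ge0.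
  rewrite big_nat_cond [leRHS]big_nat_cond.
  apply: ler_sum => m /andP[/andP[m0 _] _].
  have jk : (k <= m %/ P)%N by rewrite leq_divRL // mulnC.
  have m1 : (0 < m)%N by apply: leq_trans m0; rewrite muln_gt0 P0 ltnW.
  have j0 : (0 < m %/ P)%N by apply: leq_trans jk; apply: ltnW.
  rewrite /f ltnNge jk /= -invfM -exprMn -natrM.
  rewrite lef_pV2 ?posrE ?exprn_gt0 ?ltr0n ?muln_gt0 ?P0 //.
  by rewrite lerXn2r ?nnegrE ?ler0n // ler_nat mulnC leq_divM.
rewrite sum_coprime_blocks.
have E j : \sum_(0 <= r < P | coprime r P) f ((P * j + r) %/ P)%N =
    (totient P)%:R * f j.
  rewrite -sum_coprime_const big_nat_cond [RHS]big_nat_cond.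
  apply: eq_bigr => r /andP[/andP[_ rP] _].
  by rewrite mulnC divnMDl // divn_small // addn0.
under eq_bigr do rewrite E.
rewrite -big_distrr /=; apply: ler_wpM2l; first by rewrite ler0n.
case: (leqP k n) => nk; last first.
  rewrite big_nat_cond big1; first by rewrite mulr_ge0 ?B0 // invr_ge0 ler0n.
  by move=> j /andP[/andP[_ jn] _]; rewrite /f (ltn_trans jn nk).
rewrite (big_cat_nat (n := k)) //= big_nat_cond big1 ?add0r; last first.
  by move=> j /andP[/andP[_ jn] _]; rewrite /f jn.
apply: (@le_trans _ _ (\sum_(k <= j < n) (P%:R ^+ 2)^-1 * (j%:R ^+ 2)^-1)).
  rewrite big_nat_cond [leRHS]big_nat_cond; apply: ler_sum => j.
  by move=> /andP[/andP[jk _] _]; rewrite /f ltnNge jk.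
rewrite -big_distrr /=; apply: ler_wpM2l; [exact: B0 | exact: inv_square_tail].
Qed.
End Numerics.

Local Open Scope classical_set_scope.

(** If C < 0.6919, the right side is at most 0.7135303 + 0.000011, which is below the lower bound
    0.713542 of the left side. *)
Lemma lower_numerics (R : realFieldType) (C h Z : R) :
  (((31 * 100 + 21) * 100 + 74) * 100 + 88) / (10 * 100 * 100 * 100) <= h ->
  1 <= Z ->
  Z <= (((10 * 100 + 31) * 100 + 26) * 100 + 21) / (10 * 100 * 100 * 100) ->
  48 / 210 * h <= C * Z + 48 * ((210 ^+ 2)^-1 * 100.-1%:R^-1) ->
  6919 / 10000 <= C.
Proof.
have -> : 6919 / 10000 = (69 * 100 + 19) / (100 * 100) :> R by field.
have T_le : 48 * ((210 ^+ 2)^-1 * 100.-1%:R^-1) <= 11 / (100 * 100 * 100) :> R.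
  by rewrite /=; lra.
move=> h_ge Z_ge1 Z_le le; rewrite leNgt; apply/negP => lt.
have CZ : C * Z <= (69 * 100 + 19) / (100 * 100) * Z.
  by rewrite ler_wpM2r ?(ltW lt) // (le_trans _ Z_ge1).
have {}h_ge :
    ((71 * 100 + 35) * 100 + 42) / (100 * 100 * 100) <= 48 / 210 * h.
  by clear - h_ge; lra.
have {}Z_le : (69 * 100 + 19) / (100 * 100) * Z <=
    (((71 * 100 + 35) * 100 + 30) * 100 + 30) / (100 * 100 * 100 * 100).
  by clear - Z_le; lra.
have := le_trans h_ge (le_trans le (lerD (le_trans CZ Z_le) T_le)).
by clear; rewrite leNgt => /negP; apply; lra.
Qed.

(** * Bounds on the limit *)

Section Bounds.
Variables (R : realType) (C : R).
Hypothesis limC : forall eps, 0 < eps -> exists N, forall n, (N <= n)%N ->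
  (C - eps) * n%:R <= (F 3 3 n)%:R <= (C + eps) * n%:R.

Section Modulus.
Variables (P : nat) (js : seq nat).
Hypotheses (P1 : (1 < P)%N) (js0 : all (leq 1) js).
Let P0 : (0 < P)%N := ltnW P1.
Let rho : R := (totient P)%:R / P%:R.
Let h : R := rho * \sum_(j <- js) j%:R^-1.
Let K : R := 2 * (totient P)%:R * (size js)%:R.

Lemma limit_upper :
  (forall x, maxfree (smooth P) x <= \sum_(j <- js) (j <= x))%N -> C <= h.
Proof.
move=> upper; apply/ler_addgt0Pr => eps eps0; rewrite -subr_le0.
have [N HN] := limC eps0; apply: (@le0_of_bounded _ _ K N) => n /HN/andP[lo _].
have /andP[_ up] := @sum_ncop R P _ n P1 js0.
have : (F 3 3 n)%:R <= \sum_(j <- js) ncop R P (n %/ j).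
  rewrite -sum_steps // ler_nat F_maxfree.
  apply: (leq_trans (maxfree_upper P0 n)).
  by apply: leq_sum => v _; apply: upper.
move/(le_trans lo)/le_trans/(_ up); rewrite -/rho -/h -/K; lra.
Qed.

(** For m < M the limit bounds F(n / m^2); from M on the trivial bound F y <= y is used, so that the
    tail T enters without the factor C. *)
Lemma limit_lower M (T : R) : (0 < M)%N ->
  (forall x, \sum_(j <- js) (j <= x) <= maxfree (smooth P) x)%N ->
  (forall n, \sum_(M <= m < n | coprime m P) (m%:R ^+ 2)^-1 <= T) ->
  h <= C * \sum_(1 <= m < M | coprime m P) (m%:R ^+ 2)^-1 + T.
Proof.
move=> M0 lower tail; set Z : R := \sum_(_ <= _ < _ | _) _.
have Z0 : 0 <= Z by apply: sumr_ge0 => m _; rewrite invr_ge0 exprn_ge0 ?ler0n.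
have C0 : 0 <= C.
  apply/ler_addgt0Pl => eps eps0; rewrite -oppr_le0.
  have [N HN] := limC eps0; apply: (@le0_of_bounded _ _ 0 N) => n /HN/andP[_].
  by move/(le_trans (ler0n _ _)); rewrite mulNr oppr_le0 addrC.
have main eps : 0 < eps -> h <= (C + eps) * Z + T.
  move=> eps0; have [N HN] := limC eps0; have ceps : 0 <= C + eps by lra.
  (* The constant N covers the arguments y < N, where F y <= y. *)
  have uD y : (F 3 3 y)%:R <= (C + eps) * y%:R + N%:R :> R.
    case: (leqP N y) => [/HN/andP[_ /le_trans]|yN]; first by apply; rewrite lerDl.
    apply: (le_trans (u_le R y)); rewrite -[leLHS]add0r lerD //.
      by rewrite mulr_ge0.
    by rewrite ler_nat ltnW.
  rewrite -subr_le0; pose D : R := \sum_(1 <= m < M | coprime m P) N%:R.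
  apply: (@le0_of_bounded _ _ (K + D) M) => n Mn.
  have /andP[lo _] := @sum_ncop R P _ n P1 js0; rewrite -/rho -/h -/K in lo.
  have n0 : 0 <= n%:R :> R by rewrite ler0n.
  have : \sum_(j <- js) ncop R P (n %/ j) <=
      \sum_(1 <= m < n.+1 | coprime m P) (F 3 3 (n %/ m ^ 2))%:R.
    rewrite -sum_steps // -natr_sum ler_nat.
    under [leqRHS]eq_bigr do rewrite F_maxfree.
    apply: (leq_trans _ (maxfree_lower P0 n)).
    by apply: leq_sum => v _; apply: lower.
  rewrite (big_cat_nat (n := M)) //=; last by rewrite leqW.
  have : \sum_(1 <= m < M | coprime m P) (F 3 3 (n %/ m ^ 2))%:R <=
      (C + eps) * Z * n%:R + D :> R.
    rewrite /Z /D mulr_sumr mulr_suml -big_split /=.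
    rewrite big_nat_cond [leRHS]big_nat_cond; apply: ler_sum => m.
    move=> /andP[/andP[m0 _] _]; apply: (le_trans (uD _)).
    rewrite lerD2r -mulrA; apply: ler_wpM2l => //.
    by rewrite mulrC; apply: div_square_le.
  have : \sum_(M <= m < n.+1 | coprime m P) (F 3 3 (n %/ m ^ 2))%:R <=
      T * n%:R :> R.
    apply: (@le_trans _ _ (\sum_(M <= m < n.+1 | coprime m P)
              n%:R * (m%:R ^+ 2)^-1)).
      rewrite big_nat_cond [leRHS]big_nat_cond; apply: ler_sum => m.
      move=> /andP[/andP[mM _] _]; apply: (le_trans (u_le R _)).
      by apply: div_square_le; apply: leq_trans mM.
    by rewrite -mulr_sumr mulrC; apply: ler_wpM2r.
  move: (\sum_(M <= _ < _ | _) _) (\sum_(1 <= _ < M | _) _) => s1 s2.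
  move: lo; move: (\sum_(_ <- _) _) => s3; lra.
apply/ler_addgt0Pr => eps eps0.
(* Division by Z + 1 keeps the excess, which gets multiplied by Z, below eps. *)
have e1 : 0 < eps / (Z + 1) by rewrite divr_gt0 // ltr_wpDl.
apply: (le_trans (main _ e1)).
have : eps / (Z + 1) * Z <= eps.
  rewrite -mulrA ler_piMr ?(ltW eps0) // mulrC ler_pdivrMr ?ltr_wpDl //.
  by rewrite mul1r lerDl.
lra.
Qed.
End Modulus.

Lemma limit_bounds : 6919 / 10000 <= C /\ C <= 7136 / 10000.
Proof.
have tot : (totient 210)%:R = 48 :> R by congr _%:R.
split.
- have js0 : all (leq 1) (map Z.to_nat attained) by [].
  have := @limit_lower 210 _ isT js0 _ _ (isT : (0 < 210 * 100)%N)
    maxfree210_lower (fun n => @squares_tail R 210 100 n isT isT).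
  rewrite tot.
  have := attained_bound R; have := squares_bound R.
  set h := \sum_(_ <- _) _; set Z := \sum_(_ <= _ < _ | _) _ => Zle hge le.
  have Z1 : 1 <= Z.
    rewrite /Z big_ltn_cond //= expr1n invr1 lerDl.
    by apply: sumr_ge0 => m _; rewrite invr_ge0 exprn_ge0 ?ler0n.
  exact: (lower_numerics hge Z1 Zle le).
- have js0 : all (leq 1) (jumps certs) by [].
  apply: (le_trans (@limit_upper 210 _ isT js0 maxfree210_upper)); rewrite tot.
  have := jumps_bound R; lra.
Qed.
End Bounds.

Theorem theorem4 (R : realType) :
  exists C : R,
    [/\ 6919 / 10000 <= C, C <= 7136 / 10000
      & exists e : nat -> R,
          (e n @[n --> \oo] --> (0 : R)) /\
          forall n : nat, (1 <= n)%N -> (F 3 3 n)%:R = (C + e n) * n%:R].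
Proof.
have [C limC] := F_limit R; have [lo up] := limit_bounds limC.
exists C; split=> //; exists (fun n => (F 3 3 n)%:R / n%:R - C); split; last first.
  by move=> n n1; rewrite addrC subrK divfK // pnatr_eq0 -lt0n.
apply/cvgrPdist_le => eps eps0; have [N HN] := limC eps eps0.
(* The maximum with 1 keeps n nonzero for the divisions by n. *)
exists (maxn 1 N) => // n; rewrite /= geq_max => /andP[n1 /HN/andP[h1 h2]].
have n0 : 0 < n%:R :> R by rewrite ltr0n.
rewrite sub0r normrN ler_norml lerBrDr lerBlDr.
by rewrite ler_pdivlMr // ler_pdivrMr // [- eps + C]addrC [eps + C]addrC h1 h2.
Qed.
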